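(* Let $f\in\mathcal{C}$, with second Taylor coefficient $a_2=f''(0)/2$, and suppose that there exists $\zeta\in\partial\mathbb{D}$ for which $f(\zeta)$ is a finite boundary point (that is, $f(\zeta)\neq\infty$) and $$\mathrm{Re}\{a_2f(\zeta)\}=-\frac12 .$$ Then $f$ maps $\mathbb{D}$ either onto a halfplane or onto an infinite sector.
   Context: $\mathbb{D}$ is the open unit disk in $\mathbb{C}$. $\mathcal{C}$ is the class of convex mappings: functions $f$ analytic and univalent in $\mathbb{D}$ with $f(0)=0$, $f'(0)=1$ and $f(\mathbb{D})$ convex. Every $f\in\mathcal{C}$ extends to a map $\overline{\mathbb{D}}\to\hat{\mathbb{C}}=\mathbb{C}\cup\{\infty\}$ that is continuous in the spherical metric, and $f(\zeta)$ for $\zeta\in\partial\mathbb{D}$ denotes the value of this extension. An infinite sector is a (convex) region bounded by two rays issuing from a common finite vertex, i.e. the image under a map $w\mapsto Aw+B$, $A\ne0$, of $\{w\neq 0: |\arg w|<\pi\beta/2\}$ for some $\beta\in(0,1)$. *)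

(* Defs.v *)
(* Classical reals of the standard library, complex numbers of Coquelicot. *)
From Stdlib Require Import Reals.
From Coquelicot Require Import Coquelicot.
Open Scope R_scope.

Definition disk (z : C) : Prop := Cmod z < 1.

Definition analytic_at (f : C -> C) (z0 : C) : Prop :=
  exists (a : nat -> C_NormedModule) (r : R), 0 < r /\
    forall z : C, Cmod (z - z0) < r ->
      @is_pseries C_AbsRing C_NormedModule a (z - z0)%C (f z).

Definition analytic_on (D : C -> Prop) (f : C -> C) : Prop :=
  forall z, D z -> analytic_at f z.

Definition injective_on (D : C -> Prop) (f : C -> C) : Prop :=
  forall z1 z2, D z1 -> D z2 -> f z1 = f z2 -> z1 = z2.

Definition image (f : C -> C) (D : C -> Prop) (w : C) : Prop :=
  exists z, D z /\ f z = w.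

Definition convex_set (S : C -> Prop) : Prop :=
  forall (w1 w2 : C) (t : R), S w1 -> S w2 -> 0 <= t <= 1 ->
    S (RtoC (1 - t) * w1 + RtoC t * w2)%C.

(* The values of [f] outside the disk are irrelevant. *)
Definition convex_mapping (f : C -> C) : Prop :=
  analytic_on disk f /\ injective_on disk f /\
  f 0 = RtoC 0 /\ C_derive f 0 = RtoC 1 /\
  convex_set (image f disk).

Definition second_coeff (f : C -> C) : C := (C_derive (C_derive f) 0 / 2)%C.

Inductive sphere : Type :=
  | Fin (z : C)
  | Infty.

Definition chordal (p q : sphere) : R :=
  match p, q with
  | Fin z, Fin w =>
      2 * Cmod (z - w) / (sqrt (1 + Cmod z ^ 2) * sqrt (1 + Cmod w ^ 2))
  | Fin z, Infty | Infty, Fin z => 2 / sqrt (1 + Cmod z ^ 2)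
  | Infty, Infty => 0
  end.

Definition spherical_extension (f : C -> C) (F : C -> sphere) : Prop :=
  (forall z, disk z -> F z = Fin (f z)) /\
  (forall z, Cmod z <= 1 ->
     filterlim (fun z' => chordal (F z') (F z))
       (within (fun z' => Cmod z' <= 1) (locally z)) (locally 0)).

(* The value at a point [zeta] of the unit circle of the spherically continuous
   extension of [f] is the limit of [f] at [zeta], from inside the disk, in the
   spherical metric; see [spherical_extension_boundary_value]. *)
Definition boundary_value (f : C -> C) (zeta : C) (W : sphere) : Prop :=
  filterlim (fun z => chordal (Fin (f z)) W)
    (within disk (locally zeta)) (locally 0).

Lemma spherical_extension_boundary_value (f : C -> C) (F : C -> sphere)
  (zeta : C) :
  spherical_extension f F -> Cmod zeta = 1 -> boundary_value f zeta (F zeta).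
Proof.
intros [Hf HF] Hz.
assert (L := HF zeta (Req_le _ _ Hz)).
intros P HP.
specialize (L P HP).
unfold filtermap, within in L |- *.
revert L; apply filter_imp; intros z Hz1 Dz.
rewrite <- (Hf z Dz).
apply Hz1, Rlt_le, Dz.
Qed.

Definition affine_image (A B : C) (S : C -> Prop) : C -> Prop :=
  image (fun w => (A * w + B)%C) S.

Definition is_halfplane (S : C -> Prop) : Prop :=
  exists A B : C, A <> RtoC 0 /\
    forall w, S w <-> affine_image A B (fun w => 0 < Re w) w.

Definition is_arg (w : C) (theta : R) : Prop :=
  - PI < theta <= PI /\
  w = (RtoC (Cmod w) * (cos theta, sin theta))%C.

(* The condition [w <> 0] makes the principal argument [theta] unique. *)
Definition standard_sector (beta : R) (w : C) : Prop :=
  w <> RtoC 0 /\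
  exists theta, is_arg w theta /\ Rabs theta < PI * beta / 2.

Definition is_infinite_sector (S : C -> Prop) : Prop :=
  exists (beta : R) (A B : C), 0 < beta < 1 /\ A <> RtoC 0 /\
    forall w, S w <-> affine_image A B (standard_sector beta) w.

(* Main.v *)
Require Import Defs.
From Stdlib Require Import Reals Lra Lia Classical ClassicalEpsilon.
From Coquelicot Require Import Coquelicot.
Open Scope R_scope.

(* The maps [psi_s = f^-1 ((1 - s) f + s w)] are self-maps of the disk, because the
   image is convex with [w] in its closure.  Their generator is [G = (w - f) / f'],
   and the maximum principle gives [Re q >= 0] for
   [q z = (w - conj w z^2 - G z) / z].  As [q 0 = 1 + 2 a_2 w], the hypothesis says
   that [Re q] attains its minimum at [0]; hence [q] is constant, [G] generates a
   group of automorphisms of the disk, and the image is invariant under all positive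
   dilations about [w].  An open convex cone in the plane that misses its vertex is a
   halfplane or a sector. *)

(** * Complex differentiability *)

(** Convexity gives the contractions towards [w]; the difficulty is to invert them. On the unit
    circle [Re (conj z * G z) = - Re (q z)] formally, so [Re q] measures how far the generator is
    from being tangent to the circle. Once [q] is a constant [k] with [Re k = 0],
    [G z = w - k z - conj w z^2] is tangent to the circle, its flow can be run backwards for all
    time without leaving the disk, and the image contains the expansions from [w] as well. The value
    [q 0 = 1 + 2 a_2 w] comes from [G 0 = w] and [G' 0 = -1 - w f'' 0]. The inequality [Re q >= 0]
    is the derivative at [s = 0] of an inequality for self-maps that is an equality at the identity.

    Power series serve only to provide derivatives. Everything else rests on a maximum principle
    with one exceptional point, proved by the second derivative test; it yields openness of [f],
    nonvanishing of [f'] and the Schwarz estimate without Cauchy's formula. *)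

Lemma Cmod_sub_sym (a b : C) : Cmod (a - b) = Cmod (b - a).
Proof. rewrite <- Cmod_opp; f_equal; ring. Qed.

Lemma Cmod_sub_self (a : C) : Cmod (a - a) = 0.
Proof. replace (a - a)%C with (RtoC 0) by ring; apply Cmod_0. Qed.

Lemma Cmod_sub_triangle (a b c : C) : Cmod (a - c) <= Cmod (a - b) + Cmod (b - c).
Proof. replace (a - c)%C with ((a - b) + (b - c))%C by ring; apply Cmod_triangle. Qed.

Lemma Cmod_triangle_rev (a b : C) : Cmod a - Cmod b <= Cmod (a - b).
Proof.
generalize (Cmod_triangle (a - b) b).
replace (a - b + b)%C with a by ring; lra.
Qed.

Lemma Cmod_sub_gt0 (a b : C) : a <> b -> 0 < Cmod (a - b).
Proof. intros H; apply Cmod_gt_0; intros E; apply H. replace a with ((a - b) + b)%C by ring. rewrite E; ring. Qed.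

Lemma Cmod_lt_eps_0 (a : C) : (forall e, 0 < e -> Cmod a <= e) -> a = 0.
Proof.
intros H; apply Cmod_eq_0; destruct (Cmod_ge_0 a) as [H1 | H1]; [ | now rewrite H1].
specialize (H (Cmod a / 2)); lra.
Qed.

Lemma Re_le_Cmod (a : C) : Re a <= Cmod a.
Proof. generalize (re_le_Cmod a) (Rle_abs (Re a)); lra. Qed.

Lemma Im_le_Cmod (a : C) : Rabs (Im a) <= Cmod a.
Proof. eapply Rle_trans; [ apply Rmax_r | apply (Rmax_Cmod a)]. Qed.

Lemma Cmod_le_Re_Im (a : C) : Cmod a <= Rabs (Re a) + Rabs (Im a).
Proof.
assert (H := Cmod2_alt a).
assert (H1 := Rabs_pos (Re a)); assert (H2 := Rabs_pos (Im a)).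
rewrite <- (pow2_abs (Re a)), <- (pow2_abs (Im a)) in H.
apply Rnot_lt_le; intros K; nra.
Qed.

Lemma Csub_ne_0 (a b : C) : a <> b -> (a - b)%C <> RtoC 0.
Proof. intros H E; apply H; replace a with ((a - b) + b)%C by ring; rewrite E; ring. Qed.

Definition ccont (f : C -> C) (z : C) : Prop :=
  forall e, 0 < e -> exists d, 0 < d /\
    forall u, Cmod (u - z) < d -> Cmod (f u - f z) < e.

(* Caratheodory's form of complex differentiability. *)
Definition cder (f : C -> C) (z l : C) : Prop :=
  exists phi, ccont phi z /\ phi z = l /\
    forall u, f u = (f z + phi u * (u - z))%C.

Lemma ccont_ext_loc (f g : C -> C) (z : C) (r : R) :
  0 < r -> (forall u, Cmod (u - z) < r -> f u = g u) -> ccont f z -> ccont g z.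
Proof.
intros Hr E H e He; destruct (H e He) as [d [Hd Hf]].
exists (Rmin d r); split; [ now apply Rmin_glb_lt | ].
intros u Hu; rewrite <- (E u), <- (E z).
- apply Hf; eapply Rlt_le_trans; [ exact Hu | apply Rmin_l].
- now rewrite Cmod_sub_self.
- eapply Rlt_le_trans; [ exact Hu | apply Rmin_r].
Qed.

Lemma ccont_const (c z : C) : ccont (fun _ => c) z.
Proof. intros e He; exists 1; split; [ lra | ]. intros; rewrite Cmod_sub_self; lra. Qed.

Lemma ccont_id (z : C) : ccont (fun u => u) z.
Proof. intros e He; exists e; auto. Qed.

Lemma ccont_plus (f g : C -> C) (z : C) :
  ccont f z -> ccont g z -> ccont (fun u => f u + g u)%C z.
Proof.
intros Hf Hg e He.
destruct (Hf (e/2)) as [d1 [D1 H1]]; [ lra | ].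
destruct (Hg (e/2)) as [d2 [D2 H2]]; [ lra | ].
exists (Rmin d1 d2); split; [ now apply Rmin_glb_lt | ].
intros u Hu.
assert (A1 := H1 u (Rlt_le_trans _ _ _ Hu (Rmin_l _ _))).
assert (A2 := H2 u (Rlt_le_trans _ _ _ Hu (Rmin_r _ _))).
replace (f u + g u - (f z + g z))%C with ((f u - f z) + (g u - g z))%C by ring.
generalize (Cmod_triangle (f u - f z) (g u - g z)); lra.
Qed.

Lemma ccont_bounded (f : C -> C) (z : C) :
  ccont f z -> exists d, 0 < d /\ forall u, Cmod (u - z) < d -> Cmod (f u) <= Cmod (f z) + 1.
Proof.
intros H; destruct (H 1 Rlt_0_1) as [d [Hd K]]; exists d; split; auto.
intros u Hu; specialize (K u Hu); generalize (Cmod_triangle_rev (f u) (f z)); lra.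
Qed.

Lemma ccont_mult (f g : C -> C) (z : C) :
  ccont f z -> ccont g z -> ccont (fun u => f u * g u)%C z.
Proof.
intros Hf Hg e He.
destruct (ccont_bounded f z Hf) as [d0 [D0 H0]].
assert (P1 := Cmod_ge_0 (f z)); assert (P2 := Cmod_ge_0 (g z)).
assert (Q1 : 0 < e / (2 * (Cmod (g z) + 1))) by (apply Rdiv_lt_0_compat; lra).
assert (Q2 : 0 < e / (2 * (Cmod (f z) + 1))) by (apply Rdiv_lt_0_compat; lra).
destruct (Hf _ Q1) as [d1 [D1 H1]].
destruct (Hg _ Q2) as [d2 [D2 H2]].
exists (Rmin d0 (Rmin d1 d2)); split; [ repeat apply Rmin_glb_lt; auto | ].
intros u Hu.
assert (U0 : Cmod (u - z) < d0) by (eapply Rlt_le_trans; [ exact Hu | apply Rmin_l]).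
assert (U' : Cmod (u - z) < Rmin d1 d2) by (eapply Rlt_le_trans; [ exact Hu | apply Rmin_r]).
assert (U1 := H1 u (Rlt_le_trans _ _ _ U' (Rmin_l _ _))).
assert (U2 := H2 u (Rlt_le_trans _ _ _ U' (Rmin_r _ _))).
specialize (H0 u U0).
replace (f u * g u - f z * g z)%C with (f u * (g u - g z) + (f u - f z) * g z)%C by ring.
eapply Rle_lt_trans; [ apply Cmod_triangle | ].
rewrite !Cmod_mult.
assert (A1 : Cmod (f u) * Cmod (g u - g z) <= (Cmod (f z) + 1) * Cmod (g u - g z)).
{ apply Rmult_le_compat_r; [ apply Cmod_ge_0 | lra]. }
assert (A2 : (Cmod (f z) + 1) * Cmod (g u - g z) < e / 2).
{ replace (e / 2) with ((Cmod (f z) + 1) * (e / (2 * (Cmod (f z) + 1)))) by (field; lra).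
  apply Rmult_lt_compat_l; lra. }
assert (A3 : Cmod (f u - f z) * Cmod (g z) <= e / 2).
{ replace (e / 2) with ((e / (2 * (Cmod (g z) + 1))) * (Cmod (g z) + 1)) by (field; lra).
  apply Rmult_le_compat; try apply Cmod_ge_0; lra. }
lra.
Qed.

Lemma ccont_inv (f : C -> C) (z : C) :
  ccont f z -> f z <> RtoC 0 -> ccont (fun u => / f u)%C z.
Proof.
intros Hf Hz e He.
assert (P := proj1 (Cmod_gt_0 _) Hz).
assert (Q : 0 < Rmin (Cmod (f z) / 2) (e * (Cmod (f z) * Cmod (f z)) / 2)).
{ apply Rmin_glb_lt; [ lra | ]. apply Rdiv_lt_0_compat; [ | lra].
  repeat apply Rmult_lt_0_compat; auto. }
destruct (Hf _ Q) as [d [D H]].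
exists d; split; auto; intros u Hu; specialize (H u Hu).
assert (H1 : Cmod (f u - f z) < Cmod (f z) / 2) by (eapply Rlt_le_trans; [ exact H | apply Rmin_l]).
assert (H2 : Cmod (f u - f z) < e * (Cmod (f z) * Cmod (f z)) / 2) by (eapply Rlt_le_trans; [ exact H | apply Rmin_r]).
assert (H3 : Cmod (f z) / 2 < Cmod (f u)).
{ generalize (Cmod_triangle_rev (f z) (f u)); rewrite (Cmod_sub_sym (f z)); lra. }
assert (Hu0 : f u <> RtoC 0) by (apply Cmod_gt_0; lra).
replace (/ f u - / f z)%C with ((f z - f u) * / (f u * f z))%C by (field; auto).
rewrite Cmod_mult, Cmod_inv, Cmod_mult by (apply Cmult_neq_0; auto).
rewrite Cmod_sub_sym.
apply Rmult_lt_reg_r with (Cmod (f u) * Cmod (f z)); [ apply Rmult_lt_0_compat; lra | ].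
rewrite Rmult_assoc, Rinv_l by (apply Rgt_not_eq, Rmult_lt_0_compat; lra).
rewrite Rmult_1_r; eapply Rlt_le_trans; [ exact H2 | ].
replace (e * (Cmod (f z) * Cmod (f z)) / 2) with (e * (Cmod (f z) / 2 * Cmod (f z))) by field.
apply Rmult_le_compat_l; [ lra | ]; apply Rmult_le_compat_r; lra.
Qed.

Lemma ccont_comp (f g : C -> C) (z : C) :
  ccont f (g z) -> ccont g z -> ccont (fun u => f (g u)) z.
Proof.
intros Hf Hg e He; destruct (Hf e He) as [d [D H]].
destruct (Hg d D) as [d' [D' H']]; exists d'; split; auto.
Qed.

(** Caratheodory's form makes products, compositions and inverses algebraic, but asks for an
    identity at every [u]. The epsilon form is the one that is visibly local and suited to
    estimates. *)
Lemma cder_eps (f : C -> C) (z l : C) :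
  cder f z l <->
  forall e, 0 < e -> exists d, 0 < d /\
    forall u, Cmod (u - z) < d -> Cmod (f u - f z - l * (u - z)) <= e * Cmod (u - z).
Proof.
split.
- intros [phi [Hc [Hl Hf]]] e He.
  destruct (Hc e He) as [d [D H]]; exists d; split; auto; intros u Hu.
  rewrite (Hf u), <- Hl.
  replace (f z + phi u * (u - z) - f z - phi z * (u - z))%C with ((phi u - phi z) * (u - z))%C by ring.
  rewrite Cmod_mult; apply Rmult_le_compat_r; [ apply Cmod_ge_0 | ]; left; auto.
(* The witness is the divided difference, with the value [l] at [z] itself, so that its continuity
   there is differentiability of [f]. *)
- intros H.
  exists (fun u => if excluded_middle_informative (u = z) then l else (f u - f z) / (u - z))%C.
  split; [ | split].
  + intros e He; destruct (H (e / 2)) as [d [D K]]; [ lra | ].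
    exists d; split; auto; intros u Hu.
    destruct (excluded_middle_informative (z = z)) as [_ | N]; [ | now elim N].
    destruct (excluded_middle_informative (u = z)) as [E | N].
    * rewrite Cmod_sub_self; auto.
    * specialize (K u Hu); assert (P := Cmod_sub_gt0 _ _ N); assert (N' := Csub_ne_0 _ _ N).
      replace (f u - f z - l * (u - z))%C with (((f u - f z) / (u - z) - l) * (u - z))%C in K by (field; auto).
      rewrite Cmod_mult in K; apply Rmult_le_reg_r in K; auto; lra.
  + destruct (excluded_middle_informative (z = z)) as [_ | N]; [ auto | now elim N].
  + intros u; destruct (excluded_middle_informative (u = z)) as [E | N].
    * subst u; ring.
    * assert (N' := Csub_ne_0 _ _ N); field; auto.
Qed.

Lemma cder_ccont (f : C -> C) (z l : C) : cder f z l -> ccont f z.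
Proof.
intros [phi [Hc [Hl Hf]]].
apply (ccont_ext_loc (fun u => f z + phi u * (u + - z))%C) with 1; [ lra | intros; symmetry; apply Hf | ].
apply ccont_plus; [ apply ccont_const | apply ccont_mult; auto ].
apply ccont_plus; [ apply ccont_id | apply ccont_const].
Qed.

Lemma cder_ext_loc (f g : C -> C) (z l : C) (r : R) :
  0 < r -> (forall u, Cmod (u - z) < r -> f u = g u) -> cder f z l -> cder g z l.
Proof.
intros Hr E H; rewrite cder_eps in H |- *; intros e He.
destruct (H e He) as [d [D K]]; exists (Rmin d r); split; [ now apply Rmin_glb_lt | ].
intros u Hu; rewrite <- (E u), <- (E z).
- apply K; eapply Rlt_le_trans; [ exact Hu | apply Rmin_l].
- now rewrite Cmod_sub_self.
- eapply Rlt_le_trans; [ exact Hu | apply Rmin_r].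
Qed.

Lemma cder_unique (f : C -> C) (z l l' : C) : cder f z l -> cder f z l' -> l = l'.
Proof.
intros H H'; rewrite cder_eps in H, H'.
replace l with ((l - l') + l')%C by ring.
rewrite (Cmod_lt_eps_0 (l - l')); [ ring | ]; intros e He.
destruct (H (e/2)) as [d [D K]]; [ lra | ].
destruct (H' (e/2)) as [d' [D' K']]; [ lra | ].
assert (Dm : 0 < Rmin d d') by now apply Rmin_glb_lt.
set (u := (z + RtoC (Rmin d d' / 2))%C).
assert (Eu : (u - z)%C = RtoC (Rmin d d' / 2)) by (unfold u; ring).
assert (Mu : Cmod (u - z) = Rmin d d' / 2) by (rewrite Eu, Cmod_R, Rabs_pos_eq; lra).
assert (M1 := Rmin_l d d'); assert (M2 := Rmin_r d d').
assert (A1 := K u ltac:(lra)); assert (A2 := K' u ltac:(lra)).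
apply Rmult_le_reg_r with (Cmod (u - z)); [ lra | ].
rewrite <- Cmod_mult.
replace ((l - l') * (u - z))%C with ((f u - f z - l' * (u - z)) - (f u - f z - l * (u - z)))%C by ring.
eapply Rle_trans; [ apply Cmod_triangle | ].
rewrite Cmod_opp; lra.
Qed.

Lemma cder_const (c z : C) : cder (fun _ => c) z 0.
Proof. exists (fun _ => RtoC 0); repeat split; [ apply ccont_const | intros; ring]. Qed.

Lemma cder_id (z : C) : cder (fun u => u) z 1.
Proof. exists (fun _ => RtoC 1); repeat split; [ apply ccont_const | intros; ring]. Qed.

Lemma cder_plus (f g : C -> C) (z a b : C) :
  cder f z a -> cder g z b -> cder (fun u => f u + g u)%C z (a + b).
Proof.
intros [p [Pc [Pa Pf]]] [q [Qc [Qb Qf]]].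
exists (fun u => p u + q u)%C; split; [ now apply ccont_plus | split; [ now subst | ]].
intros u; rewrite (Pf u), (Qf u); ring.
Qed.

Lemma cder_mult (f g : C -> C) (z a b : C) :
  cder f z a -> cder g z b -> cder (fun u => f u * g u)%C z (a * g z + f z * b).
Proof.
intros Hf Hg; assert (Cg := cder_ccont _ _ _ Hg).
destruct Hf as [p [Pc [Pa Pf]]]; destruct Hg as [q [Qc [Qb Qf]]].
exists (fun u => p u * g u + f z * q u)%C; split; [ | split; [ now subst | ]].
- apply ccont_plus; apply ccont_mult; auto; apply ccont_const.
- intros u; rewrite (Pf u), (Qf u); ring.
Qed.

Lemma cder_inv (f : C -> C) (z a : C) :
  cder f z a -> f z <> RtoC 0 -> cder (fun u => / f u)%C z (- a * / (f z * f z)).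
Proof.
intros Hf Hz; assert (Cf := cder_ccont _ _ _ Hf).
destruct (Cf (Cmod (f z))) as [d [D H]]; [ now apply Cmod_gt_0 | ].
destruct Hf as [p [Pc [Pa Pf]]].
(* The divided difference of [/ f] has this form only where [f u] is nonzero, so the identity is
   stated for a function that agrees with [/ f] near [z]. *)
apply (cder_ext_loc (fun u => / f z + (- (1) * p u * / (f u * f z)) * (u - z))%C) with d; auto.
- intros u Hu.
  assert (Hu0 : f u <> RtoC 0).
  { intros E; specialize (H u Hu); rewrite E in H.
    replace (0 - f z)%C with (- f z)%C in H by ring; rewrite Cmod_opp in H; lra. }
  assert (Eu : (p u * (u - z))%C = (f u - f z)%C) by (rewrite (Pf u) at 1; ring).
  replace (- (1) * p u * / (f u * f z) * (u - z))%C with (- (1) * (p u * (u - z)) * / (f u * f z))%C by ring.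
  rewrite Eu; field; auto.
- exists (fun u => - (1) * p u * / (f u * f z))%C; split; [ | split].
  + apply ccont_mult; [ apply ccont_mult; auto; apply ccont_const | ].
    apply ccont_inv; [ apply ccont_mult; auto; apply ccont_const | now apply Cmult_neq_0].
  + subst a; ring.
  + intros u; ring.
Qed.

Lemma cder_comp (f g : C -> C) (z a b : C) :
  cder f (g z) a -> cder g z b -> cder (fun u => f (g u)) z (a * b).
Proof.
intros [p [Pc [Pa Pf]]] Hg; assert (Cg := cder_ccont _ _ _ Hg).
destruct Hg as [q [Qc [Qb Qf]]].
exists (fun u => p (g u) * q u)%C; split; [ | split; [ now subst | ]].
- apply ccont_mult; auto; now apply (ccont_comp p g).
- intros u; rewrite (Pf (g u)).
  assert (E : (g u - g z)%C = (q u * (u - z))%C) by (rewrite (Qf u); ring).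
  rewrite E; ring.
Qed.

Lemma cder_value (f : C -> C) (z l l' : C) : l = l' -> cder f z l -> cder f z l'.
Proof. now intros ->. Qed.

Definition chol (f : C -> C) (z : C) : Prop := exists l, cder f z l.

(* Twice complex differentiable at [z]. *)
Definition chol2 (f : C -> C) (z : C) : Prop :=
  exists f1 r, 0 < r /\ (forall u, Cmod (u - z) < r -> cder f u (f1 u)) /\ chol f1 z.

Lemma chol2_cder (f : C -> C) (z : C) : chol2 f z -> chol f z.
Proof. intros [f1 [r [Hr [H _]]]]; exists (f1 z); apply H; rewrite Cmod_sub_self; auto. Qed.

Lemma chol_ccont (f : C -> C) (z : C) : chol f z -> ccont f z.
Proof. intros [l H]; now apply cder_ccont with l. Qed.

Lemma chol2_ccont (f : C -> C) (z : C) : chol2 f z -> ccont f z.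
Proof. intros H; now apply chol_ccont, chol2_cder. Qed.

Lemma chol_mult (f g : C -> C) (z : C) : chol f z -> chol g z -> chol (fun u => f u * g u)%C z.
Proof. intros [a Ha] [b Hb]; eexists; now apply cder_mult; eauto. Qed.

Lemma chol_plus (f g : C -> C) (z : C) : chol f z -> chol g z -> chol (fun u => f u + g u)%C z.
Proof. intros [a Ha] [b Hb]; eexists; now apply cder_plus; eauto. Qed.

Lemma chol_const (c z : C) : chol (fun _ => c) z.
Proof. eexists; apply cder_const. Qed.

Lemma chol_inv (f : C -> C) (z : C) : chol f z -> f z <> RtoC 0 -> chol (fun u => / f u)%C z.
Proof. intros [a Ha] H; eexists; apply cder_inv; eauto. Qed.

Lemma chol_comp (f g : C -> C) (z : C) : chol f (g z) -> chol g z -> chol (fun u => f (g u)) z.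
Proof. intros [a Ha] [b Hb]; eexists; eapply cder_comp; eauto. Qed.

Lemma chol2_const (c z : C) : chol2 (fun _ => c) z.
Proof.
exists (fun _ => RtoC 0), 1; split; [ lra | split]; [ intros; apply cder_const | apply chol_const].
Qed.

Lemma chol2_id (z : C) : chol2 (fun u => u) z.
Proof.
exists (fun _ => RtoC 1), 1; split; [ lra | split]; [ intros; apply cder_id | apply chol_const].
Qed.

Lemma chol2_plus (f g : C -> C) (z : C) : chol2 f z -> chol2 g z -> chol2 (fun u => f u + g u)%C z.
Proof.
intros [f1 [r [Hr [Hf Cf]]]] [g1 [s [Hs [Hg Cg]]]].
exists (fun u => f1 u + g1 u)%C, (Rmin r s); split; [ now apply Rmin_glb_lt | split; [ | now apply chol_plus]].
intros u Hu; apply cder_plus; [ apply Hf | apply Hg];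
  (eapply Rlt_le_trans; [ exact Hu | apply Rmin_l || apply Rmin_r]).
Qed.

Lemma chol2_mult (f g : C -> C) (z : C) : chol2 f z -> chol2 g z -> chol2 (fun u => f u * g u)%C z.
Proof.
intros Hf' Hg'; assert (Df := chol2_cder _ _ Hf'); assert (Dg := chol2_cder _ _ Hg').
destruct Hf' as [f1 [r [Hr [Hf Cf]]]]; destruct Hg' as [g1 [s [Hs [Hg Cg]]]].
exists (fun u => f1 u * g u + f u * g1 u)%C, (Rmin r s); split; [ now apply Rmin_glb_lt | split].
- intros u Hu; apply cder_mult; [ apply Hf | apply Hg];
  (eapply Rlt_le_trans; [ exact Hu | apply Rmin_l || apply Rmin_r]).
- apply chol_plus; apply chol_mult; auto.
Qed.

Lemma ccont_ne_0 (f : C -> C) (z : C) :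
  ccont f z -> f z <> RtoC 0 -> exists d, 0 < d /\ forall u, Cmod (u - z) < d -> f u <> RtoC 0.
Proof.
intros Cf Hz; destruct (Cf (Cmod (f z))) as [d [D H]]; [ now apply Cmod_gt_0 | ].
exists d; split; auto; intros u Hu E; specialize (H u Hu); rewrite E in H.
replace (0 - f z)%C with (- f z)%C in H by ring; rewrite Cmod_opp in H; lra.
Qed.

Lemma chol2_inv (f : C -> C) (z : C) : chol2 f z -> f z <> RtoC 0 -> chol2 (fun u => / f u)%C z.
Proof.
intros H Hz; assert (Cf := chol2_ccont _ _ H); assert (Df := chol2_cder _ _ H).
destruct H as [f1 [r [Hr [Hf Df1]]]].
destruct (ccont_ne_0 f z Cf Hz) as [d [D N]].
exists (fun u => - (1) * f1 u * / (f u * f u))%C, (Rmin r d); split; [ now apply Rmin_glb_lt | split].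
- intros u Hu.
  apply cder_value with (- f1 u * / (f u * f u))%C; [ ring | ].
  apply cder_inv; [ apply Hf | apply N]; (eapply Rlt_le_trans; [ exact Hu | apply Rmin_l || apply Rmin_r]).
- apply chol_mult; [ apply chol_mult; auto; apply chol_const | ].
  apply (chol_inv (fun u => f u * f u)%C); [ now apply chol_mult | now apply Cmult_neq_0].
Qed.

Lemma chol2_comp (f g : C -> C) (z : C) : chol2 f (g z) -> chol2 g z -> chol2 (fun u => f (g u)) z.
Proof.
intros Hf' Hg'; assert (Cg0 := chol2_ccont _ _ Hg'); assert (Dg := chol2_cder _ _ Hg').
destruct Hf' as [f1 [r [Hr [Hf Cf]]]]; destruct Hg' as [g1 [s [Hs [Hg Cg]]]].
destruct (Cg0 r Hr) as [d [D H]].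
exists (fun u => f1 (g u) * g1 u)%C, (Rmin d s); split; [ now apply Rmin_glb_lt | split].
- intros u Hu; apply cder_comp; [ apply Hf, H | apply Hg];
  (eapply Rlt_le_trans; [ exact Hu | apply Rmin_l || apply Rmin_r]).
- apply chol_mult; auto; now apply (chol_comp f1 g).
Qed.

Lemma chol2_ext_loc (f g : C -> C) (z : C) (r : R) :
  0 < r -> (forall u, Cmod (u - z) < r -> f u = g u) -> chol2 f z -> chol2 g z.
Proof.
intros Hr E [f1 [s [Hs [Hf Df]]]].
(* Halving leaves each such [u] a ball of radius [r / 2] on which [f] and [g] agree. *)
exists f1, (Rmin (r / 2) s); split; [ apply Rmin_glb_lt; lra | split; auto].
intros u Hu.
assert (Hu1 : Cmod (u - z) < r / 2) by (eapply Rlt_le_trans; [ exact Hu | apply Rmin_l]).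
apply (cder_ext_loc f g u _ (r / 2)); [ lra | | ].
- intros v Hv; apply E; generalize (Cmod_sub_triangle v u z); lra.
- apply Hf; eapply Rlt_le_trans; [ exact Hu | apply Rmin_r].
Qed.

(** * Maximum principle *)

(** A gauge on a square that contains [K]: a point of [K] gets the scale at which [P] holds around
    it, any other point gets a radius that avoids [K] and so never covers a point of [K].
    Compactness of the square bounds the scales from below. *)
Lemma compact_uniform (K : C -> Prop) (B : R) (P : R -> C -> Prop) :
  (forall z, K z -> Cmod z <= B) ->
  (forall z, ~ K z -> exists d, 0 < d /\ forall u, Cmod (u - z) < d -> ~ K u) ->
  (forall d d' z, d' <= d -> P d z -> P d' z) ->
  (forall z, K z -> exists d, 0 < d /\ forall u, K u -> Cmod (u - z) < d -> P d u) ->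
  exists d, 0 < d /\ forall z, K z -> P d z.
Proof.
intros HB Hcl Hanti Hloc.
(* The factor 2 pays for passing from the box neighbourhoods of [compactness_value_2d] to [Cmod]. *)
assert (H : forall x y : R, exists d : posreal, forall u, K u -> Cmod (u - (x, y)) < 2 * d -> P d u).
{ intros x y; destruct (classic (K (x, y))) as [k | k].
  - destruct (Hloc _ k) as [d [D H]].
    assert (D2 : 0 < d / 2) by lra; exists (mkposreal _ D2); simpl.
    intros u Ku Hu; apply Hanti with d; [ lra | apply H; auto; lra].
  - destruct (Hcl _ k) as [d [D H]].
    assert (D2 : 0 < d / 2) by lra; exists (mkposreal _ D2); simpl.
    intros u Ku Hu; elim (H u); auto; lra. }
set (delta x y := proj1_sig (constructive_indefinite_description _ (H x y))).
destruct (compactness_value_2d (- B) B (- B) B delta) as [d Hd].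
exists d; split; [ apply cond_pos | ]; intros z Kz.
apply NNPP; intros N.
assert (Bz := HB z Kz).
assert (Bx : - B <= fst z <= B) by (apply Rabs_le_between; generalize (re_le_Cmod z); unfold Re; lra).
assert (By : - B <= snd z <= B) by (apply Rabs_le_between; generalize (Im_le_Cmod z); unfold Im; lra).
apply (Hd (fst z) (snd z) Bx By); intros [x [y [_ [_ [Hx [Hy Hle]]]]]].
apply N; apply Hanti with (delta x y); auto.
apply (proj2_sig (constructive_indefinite_description _ (H x y))); auto.
fold (delta x y).
eapply Rle_lt_trans; [ apply Cmod_le_Re_Im | ]; simpl; unfold Rminus in *; lra.
Qed.

Lemma usc_max (K : C -> Prop) (B : R) (u : C -> R) :
  (forall z, K z -> Cmod z <= B) ->
  (forall z, ~ K z -> exists d, 0 < d /\ forall u, Cmod (u - z) < d -> ~ K u) ->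
  (forall z, K z -> forall e, 0 < e -> exists d, 0 < d /\
     forall z', K z' -> Cmod (z' - z) < d -> u z' < u z + e) ->
  (exists z, K z) ->
  exists z, K z /\ forall z', K z' -> u z' <= u z.
Proof.
intros HB Hcl Hu [z0 K0].
(* Boundedness above is encoded as the bound [/ d]; the disjunct [d <= 0] makes the predicate
   monotone for all real [d]. *)
destruct (compact_uniform K B (fun d z => u z <= / d /\ 0 < d \/ d <= 0)) as [d [D Hd]]; auto.
{ intros d d' z Hle [[H1 H2] | H]; [ | lra].
  destruct (Rlt_le_dec 0 d'); [ left; split; auto | now right].
  apply Rle_trans with (/ d); auto; apply Rinv_le_contravar; auto. }
{ intros z Kz; destruct (Hu z Kz 1 Rlt_0_1) as [d [D H]].
  assert (P := Rabs_pos (u z)); assert (P' := Rle_abs (u z)).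
  assert (Q : 0 < Rabs (u z) + 1) by lra.
  exists (Rmin d (/ (Rabs (u z) + 1))); split; [ apply Rmin_glb_lt; auto; now apply Rinv_0_lt_compat | ].
  intros v Kv Hv; left; split; [ | apply Rmin_glb_lt; auto; now apply Rinv_0_lt_compat].
  apply Rle_trans with (Rabs (u z) + 1).
  - specialize (H v Kv (Rlt_le_trans _ _ _ Hv (Rmin_l _ _))); lra.
  - rewrite <- (Rinv_inv (Rabs (u z) + 1)) at 1; apply Rinv_le_contravar.
    + apply Rmin_glb_lt; auto; now apply Rinv_0_lt_compat.
    + apply Rmin_r. }
destruct (completeness (fun y => exists z, K z /\ y = u z)) as [M [M1 M2]].
{ exists (/ d); intros y [z [Kz ->]]; destruct (Hd z Kz); lra. }
{ exists (u z0); eauto. }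
apply NNPP; intros N.
(* If the supremum [M] is not attained, compactness turns [u z < M] into a uniform gap [m], against
   leastness of [M]. *)
assert (Hlt : forall z, K z -> u z < M).
{ intros z Kz; destruct (M1 (u z)) as [L | L]; eauto; elim N.
  exists z; split; auto; intros z' Kz'; rewrite L; apply M1; eauto. }
destruct (compact_uniform K B (fun d z => u z <= M - d)) as [m [Dm Hm]]; auto.
{ intros; lra. }
{ intros z Kz; specialize (Hlt z Kz).
  destruct (Hu z Kz ((M - u z) / 2)) as [d' [D' H]]; [ lra | ].
  exists (Rmin d' ((M - u z) / 2)); split; [ apply Rmin_glb_lt; lra | ].
  intros v Kv Hv.
  specialize (H v Kv (Rlt_le_trans _ _ _ Hv (Rmin_l _ _))).
  generalize (Rmin_r d' ((M - u z) / 2)); lra. }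
assert (M <= M - m); [ | lra].
apply M2; intros y [z [Kz ->]]; auto.
Qed.

(** * Restriction to real lines and the second derivative test *)

Lemma cder_line (f : C -> C) (z e l : C) (t : R) :
  cder f (z + RtoC t * e) l ->
  is_derive (fun t : R => Re (f (z + RtoC t * e)%C)) t (Re (l * e)).
Proof.
intros H; apply is_derive_Reals; intros eps Heps.
assert (P := Cmod_ge_0 e).
assert (Q : 0 < eps / (2 * (Cmod e + 1))) by (apply Rdiv_lt_0_compat; lra).
rewrite cder_eps in H; destruct (H _ Q) as [d [D K]].
assert (D' : 0 < d / (Cmod e + 1)) by (apply Rdiv_lt_0_compat; lra).
exists (mkposreal _ D'); intros h Hh0 Hh; change (Rabs h < d / (Cmod e + 1)) in Hh.
set (u := (z + RtoC (t + h) * e)%C).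
assert (Eu : (u - (z + RtoC t * e))%C = (RtoC h * e)%C) by (unfold u; rewrite RtoC_plus; ring).
specialize (K u); rewrite Eu, Cmod_mult, Cmod_R in K.
assert (Hh' : Rabs h * (Cmod e + 1) < d).
{ apply Rmult_lt_reg_r with (/ (Cmod e + 1)); [ apply Rinv_0_lt_compat; lra | ].
  rewrite Rmult_assoc, Rinv_r, Rmult_1_r by lra; exact Hh. }
assert (P' := Rabs_pos_lt h Hh0).
assert (K' := K ltac:(nra)).
change (Rabs ((Re (f u) - Re (f (z + RtoC t * e)%C)) / h - Re (l * e)%C) < eps).
replace ((Re (f u) - Re (f (z + RtoC t * e)%C)) / h - Re (l * e)%C)
  with (Re (f u - f (z + RtoC t * e) - l * (RtoC h * e))%C / h).
2:{ replace (l * (RtoC h * e))%C with (RtoC h * (l * e))%C by ring.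
    unfold Cminus; rewrite !re_plus, !re_opp, re_scal_l; field; auto. }
unfold Rdiv; rewrite Rabs_mult, Rabs_inv.
apply Rmult_lt_reg_r with (Rabs h); auto.
rewrite Rmult_assoc, Rinv_l, Rmult_1_r by lra.
eapply Rle_lt_trans; [ apply re_le_Cmod | ].
eapply Rle_lt_trans; [ exact K' | ].
replace (eps * Rabs h) with (eps / (2 * (Cmod e + 1)) * (Rabs h * (2 * (Cmod e + 1)))) by (field; lra).
apply Rmult_lt_compat_l; auto; nra.
Qed.

(** Taken at 0 only, since each use parametrises a line through the candidate maximum. *)
Definition second_derive (phi : R -> R) (A : R) : Prop :=
  exists d a, 0 < d /\ (forall t, Rabs t < d -> is_derive phi t (a t)) /\ is_derive a 0 A.

Lemma second_derive_ext (phi psi : R -> R) (A : R) (r : R) :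
  0 < r -> (forall t, Rabs t < r -> phi t = psi t) -> second_derive phi A -> second_derive psi A.
Proof.
intros Hr E [d [a [D [H1 H2]]]].
exists (Rmin d (r / 2)), a; split; [ apply Rmin_glb_lt; lra | split; auto].
intros t Ht; apply (is_derive_ext_loc phi).
- assert (R2 : 0 < r / 2) by lra; exists (mkposreal _ R2); intros s Hs; apply E.
  assert (Ht2 : Rabs t < r / 2) by (eapply Rlt_le_trans; [ exact Ht | apply Rmin_r]).
  assert (Hs' : Rabs (s - t) < r / 2) by exact Hs.
  clear Hs; revert Hs'; generalize (s : R); intros x Hx.
  generalize (Rabs_triang (x - t) t); replace (x - t + t) with x by ring; lra.
- apply H1; eapply Rlt_le_trans; [ exact Ht | apply Rmin_l].
Qed.

Lemma second_derive_plus (phi psi : R -> R) (A B : R) :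
  second_derive phi A -> second_derive psi B -> second_derive (fun t => phi t + psi t) (A + B).
Proof.
intros [d [a [D [H1 H2]]]] [d' [a' [D' [H1' H2']]]].
exists (Rmin d d'), (fun t => a t + a' t); split; [ now apply Rmin_glb_lt | split].
- intros t Ht; apply (is_derive_plus (V := R_NormedModule)); [ apply H1 | apply H1'];
  (eapply Rlt_le_trans; [ exact Ht | apply Rmin_l || apply Rmin_r]).
- now apply (is_derive_plus (V := R_NormedModule)).
Qed.

Lemma second_derive_scal (k : R) (phi : R -> R) (A : R) :
  second_derive phi A -> second_derive (fun t => k * phi t) (k * A).
Proof.
intros [d [a [D [H1 H2]]]].
exists d, (fun t => k * a t); split; auto; split.
- intros t Ht; apply is_derive_scal; auto.
- now apply is_derive_scal.
Qed.

(** If [A] were positive, the derivative, which vanishes at the maximum, would be positive just to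
    the right of 0, and the mean value theorem would give a value above [phi 0]. *)
Lemma second_derive_max (phi : R -> R) (A r : R) :
  second_derive phi A -> 0 < r -> (forall t, Rabs t < r -> phi t <= phi 0) -> A <= 0.
Proof.
intros [d [a [D [H1 H2]]]] Hr Hmax.
apply Rnot_lt_le; intros HA.
assert (a0 : a 0 = 0).
{ assert (H := H1 0 ltac:(rewrite Rabs_R0; auto)).
  apply is_derive_Reals in H.
  assert (E := deriv_maximum phi (- r) r 0 (exist _ (a 0) H) ltac:(lra) ltac:(lra)).
  apply E; intros x Hx1 Hx2; apply Hmax, Rabs_def1; lra. }
apply is_derive_Reals in H2.
destruct (H2 A HA) as [[d' D'] K]; simpl in K.
set (h := Rmin (Rmin d r) d' / 2).
assert (L : 0 < Rmin (Rmin d r) d') by (repeat apply Rmin_glb_lt; auto).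
assert (L1 := Rmin_l (Rmin d r) d'); assert (L2 := Rmin_r (Rmin d r) d').
assert (L3 := Rmin_l d r); assert (L4 := Rmin_r d r).
assert (Hh : 0 < h) by (unfold h; lra).
destruct (MVT_cor2 phi a 0 h Hh) as [c [Ec [Hc1 Hc2]]].
{ intros x Hx; apply is_derive_Reals, H1, Rabs_def1; unfold h in *; lra. }
assert (Kc := K c ltac:(lra) ltac:(apply Rabs_def1; unfold h in *; lra)).
rewrite Rplus_0_l, a0, Rminus_0_r in Kc; apply Rabs_def2 in Kc.
assert (Q : 0 < a c / c) by lra.
assert (0 < a c) by (replace (a c) with (a c / c * c) by (field; lra); apply Rmult_lt_0_compat; lra).
assert (0 < a c * (h - 0)) by (apply Rmult_lt_0_compat; lra).
assert (phi h <= phi 0) by (apply Hmax, Rabs_def1; unfold h; lra); lra.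
Qed.

(** The factor [e * e] is 1 for [e = 1] and -1 for [e = Ci], so the values in these two directions
    cancel: this is the harmonicity of [Re f]. *)
Lemma second_derive_Re (f f1 : C -> C) (z e l : C) (r : R) :
  0 < r -> (forall u, Cmod (u - z) < r -> cder f u (f1 u)) -> cder f1 z l ->
  second_derive (fun t => Re (f (z + RtoC t * e)%C)) (Re (l * (e * e))%C).
Proof.
intros Hr Hf Hl.
assert (P := Cmod_ge_0 e).
exists (r / (Cmod e + 1)), (fun t => Re (f1 (z + RtoC t * e) * e)%C).
split; [ apply Rdiv_lt_0_compat; lra | split].
- intros t Ht; apply cder_line, Hf.
  replace (z + RtoC t * e - z)%C with (RtoC t * e)%C by ring.
  rewrite Cmod_mult, Cmod_R.
  assert (Rabs t * (Cmod e + 1) < r).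
  { apply Rmult_lt_reg_r with (/ (Cmod e + 1)); [ apply Rinv_0_lt_compat; lra | ].
    rewrite Rmult_assoc, Rinv_r, Rmult_1_r by lra; exact Ht. }
  generalize (Rabs_pos t); nra.
- replace (l * (e * e))%C with (l * e * e)%C by ring.
  apply (cder_line (fun u => f1 u * e)%C).
  apply cder_value with (l * e + f1 z * 0)%C; [ ring | ].
  replace (z + RtoC 0 * e)%C with z by ring.
  apply cder_mult; [ exact Hl | apply cder_const].
Qed.

(** The value changes sign when [a] and [b] are exchanged, which is the harmonicity of the logarithm
    of the modulus: a vertical line exchanges the two coordinates. *)
Lemma second_derive_ln (a b L : R) :
  0 < L -> a * a + b * b <> 0 ->
  second_derive (fun t => ln (((a + t) * (a + t) + b * b) / L))
    (2 * (b * b - a * a) / ((a * a + b * b) * (a * a + b * b))).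
Proof.
intros HL H.
assert (Hd : exists d, 0 < d /\ forall t, Rabs t < d -> 0 < (a + t) * (a + t) + b * b).
{ destruct (Req_dec b 0) as [b0 | b0].
  - exists (Rabs a); split; [ apply Rabs_pos_lt; intros E; apply H; rewrite E, b0; ring | ].
    intros t Ht; assert (a + t <> 0).
    { intros E; replace t with (- a) in Ht by lra; rewrite Rabs_Ropp in Ht; lra. }
    assert (0 < (a + t) * (a + t)) by (apply Rsqr_pos_lt; auto); nra.
  - exists 1; split; [ lra | ]; intros t _.
    assert (0 < b * b) by (apply Rsqr_pos_lt; auto).
    generalize (Rle_0_sqr (a + t)); unfold Rsqr; lra. }
destruct Hd as [d [D Hd]].
exists d, (fun t => 2 * (a + t) / ((a + t) * (a + t) + b * b)); split; [ auto | split].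
- intros t Ht; specialize (Hd t Ht); auto_derive; [ now apply Rdiv_lt_0_compat | field; lra].
- assert (H0 := Hd 0 ltac:(rewrite Rabs_R0; auto)); rewrite Rplus_0_r in H0.
  auto_derive; [ rewrite Rplus_0_r; auto | rewrite Rplus_0_r; field; auto].
Qed.

Lemma second_derive_sq (a b : R) :
  second_derive (fun t => (a + t) * (a + t) + b * b) 2.
Proof.
exists 1, (fun t => 2 * (a + t)); split; [ lra | split].
- intros t _; auto_derive; [ auto | ring].
- auto_derive; [ auto | ring].
Qed.

Definition rcont (u : C -> R) (z : C) : Prop :=
  forall e, 0 < e -> exists d, 0 < d /\ forall v, Cmod (v - z) < d -> Rabs (u v - u z) < e.

Lemma rcont_ext (u v : C -> R) (z : C) : (forall x, u x = v x) -> rcont u z -> rcont v z.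
Proof.
intros E H e He; destruct (H e He) as [d [D K]]; exists d; split; auto.
intros x Hx; rewrite <- !E; auto.
Qed.

Lemma rcont_Re (p : C -> C) (z : C) : ccont p z -> rcont (fun x => Re (p x)) z.
Proof.
intros H e He; destruct (H e He) as [d [D K]]; exists d; split; auto.
intros x Hx; specialize (K x Hx).
generalize (re_le_Cmod (p x - p z)); unfold Cminus at 1; rewrite re_plus, re_opp.
unfold Rminus; lra.
Qed.

Lemma rcont_Cmod (p : C -> C) (z : C) : ccont p z -> rcont (fun x => Cmod (p x)) z.
Proof.
intros H e He; destruct (H e He) as [d [D K]]; exists d; split; auto.
intros x Hx; specialize (K x Hx).
generalize (Cmod_triangle_rev (p x) (p z)) (Cmod_triangle_rev (p z) (p x)).
rewrite (Cmod_sub_sym (p z)); intros; apply Rabs_def1; lra.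
Qed.

Lemma rcont_plus (u v : C -> R) (z : C) : rcont u z -> rcont v z -> rcont (fun x => u x + v x) z.
Proof.
intros Hu Hv e He.
destruct (Hu (e / 2)) as [d [D K]]; [ lra | ].
destruct (Hv (e / 2)) as [d' [D' K']]; [ lra | ].
exists (Rmin d d'); split; [ now apply Rmin_glb_lt | ]; intros x Hx.
assert (T := K x (Rlt_le_trans _ _ _ Hx (Rmin_l _ _))).
assert (T' := K' x (Rlt_le_trans _ _ _ Hx (Rmin_r _ _))).
apply Rabs_def2 in T; apply Rabs_def2 in T'; apply Rabs_def1; lra.
Qed.

Lemma rcont_comp (g : R -> R) (u : C -> R) (z : C) :
  ex_derive g (u z) -> rcont u z -> rcont (fun x => g (u x)) z.
Proof.
intros Hg Hu e He.
apply (ex_derive_continuous (V := R_NormedModule)), continuity_pt_filterlim in Hg.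
destruct (Hg e He) as [a [A Ha]].
destruct (Hu a A) as [d [D K]]; exists d; split; auto; intros x Hx.
destruct (Req_dec (u x) (u z)) as [E | N].
- rewrite E, Rminus_diag, Rabs_R0; auto.
- apply Ha; split; [ split; [ exact I | auto] | ]; apply K; auto.
Qed.

Definition Cmod_sq (z : C) : R := Re z * Re z + Im z * Im z.

Lemma Cmod_sq_alt (z : C) : Cmod_sq z = Cmod z * Cmod z.
Proof. unfold Cmod_sq; generalize (Cmod2_alt z); simpl; lra. Qed.

(* A removable-singularity form: [e] may be any point, and boundedness near it is
   enough because [eps * ln |z - e|] is harmonic and tends to minus infinity there;
   [delta * |z - c|^2] makes the Laplacian strictly positive. *)
Lemma max_principle_Re (p : C -> C) (c e : C) (r M B eta : R) :
  0 < eta ->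
  (forall z, Cmod (z - c) <= r -> z <> e -> chol2 p z) ->
  (forall z, Cmod (z - c) <= r -> z <> e -> Cmod (z - e) < eta -> Re (p z) <= B) ->
  (forall z, Cmod (z - c) = r -> z <> e -> Re (p z) <= M) ->
  forall z, Cmod (z - c) <= r -> z <> e -> Re (p z) <= M.
Proof.
intros Heta Hp HB HM z0 Hz0 He0; apply Rnot_lt_le; intros Hlt.
assert (Hr0 : 0 <= r) by (generalize (Cmod_ge_0 (z0 - c)); lra).
set (m0 := Cmod_sq (z0 - e)).
assert (Hm0 : 0 < m0).
{ unfold m0; rewrite Cmod_sq_alt; assert (Q := Cmod_sub_gt0 _ _ He0); apply Rmult_lt_0_compat; auto. }
(* [L] normalises the logarithm to be at most 0 on the whole closed disk. *)
set (L := (r + Cmod (c - e)) * (r + Cmod (c - e)) + 1).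
assert (HL1 : 1 <= L) by (unfold L; generalize (Rle_0_sqr (r + Cmod (c - e))); unfold Rsqr; lra).
assert (HL : forall z, Cmod (z - c) <= r -> z <> e -> 0 < Cmod_sq (z - e) / L <= 1).
{ intros z Hz Hze; rewrite Cmod_sq_alt.
  assert (Q := Cmod_sub_gt0 _ _ Hze); assert (T := Cmod_sub_triangle z c e).
  assert (Tm : Cmod (z - e) * Cmod (z - e) <= (r + Cmod (c - e)) * (r + Cmod (c - e))) by (apply Rmult_le_compat; lra).
  split; [ apply Rdiv_lt_0_compat; [ nra | lra] | ].
  apply Rmult_le_reg_r with L; [ lra | ]; unfold Rdiv; rewrite Rmult_assoc, Rinv_l by lra.
  unfold L; lra. }
set (k := - ln (m0 / L)).
assert (Hk : 0 <= k).
{ unfold k; destruct (HL z0 Hz0 He0) as [Q1 Q2]; fold m0 in Q1, Q2.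
  assert (ln (m0 / L) <= ln 1) by (apply ln_le; lra); rewrite ln_1 in *; lra. }
set (gap := Re (p z0) - M).
(* The logarithmic term costs less than a quarter of the gap at [z0], the quadratic term adds less
   than a quarter on the closed disk; so [u z0] still exceeds [u] on the circle. *)
set (eps := gap / (4 * (k + 1))); set (del := gap / (4 * (r * r + 1))).
assert (Heps : 0 < eps) by (unfold eps, gap; apply Rdiv_lt_0_compat; lra).
assert (Hdel : 0 < del) by (unfold del, gap; apply Rdiv_lt_0_compat; nra).
set (u z := Re (p z) + (eps * ln (Cmod_sq (z - e) / L) + del * Cmod_sq (z - c))).
assert (Hu0 : M + gap / 2 < u z0).
{ unfold u; fold m0; replace (ln (m0 / L)) with (- k) by (unfold k; ring).
  assert (eps * k < gap / 4).
  { apply Rlt_le_trans with (eps * (k + 1)); [ nra | ]. right; unfold eps; field; lra. }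
  assert (0 <= del * Cmod_sq (z0 - c)) by (unfold Cmod_sq; nra).
  unfold gap in *; nra. }
assert (Hdr : del * (r * r) < gap / 4).
{ apply Rlt_le_trans with (del * (r * r + 1)); [ nra | ]. right; unfold del; field; nra. }
assert (Hcirc : forall z, Cmod (z - c) = r -> z <> e -> u z < u z0).
{ intros z Hz Hze; unfold u at 1; rewrite (Cmod_sq_alt (z - c)), Hz.
  specialize (HM z Hz Hze); destruct (HL z) as [Q1 Q2]; auto; [ lra | ].
  assert (ln (Cmod_sq (z - e) / L) <= ln 1) by (apply ln_le; auto); rewrite ln_1 in *.
  assert (eps * ln (Cmod_sq (z - e) / L) <= 0) by nra; unfold gap in *; lra. }
assert (Hnear : exists rho, 0 < rho /\ forall z, Cmod (z - c) <= r -> z <> e -> Cmod (z - e) <= rho -> u z < u z0).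
(* Where the logarithm is below [q], the bound [B] plus both perturbations stays under [u z0]. *)
{ set (q := (u z0 - B - gap) / eps).
  set (rho := Rmin (eta / 2) (Rmin 1 (L * exp q / 2))).
  assert (Hrho : 0 < rho).
  { unfold rho; repeat apply Rmin_glb_lt; try lra.
    assert (E := exp_pos q); assert (0 < L * exp q) by (apply Rmult_lt_0_compat; lra); lra. }
  exists rho; split; auto; intros z Hz Hze Hrz.
  assert (R1 : rho <= eta / 2) by apply Rmin_l.
  assert (R2 : rho <= 1) by (eapply Rle_trans; [ apply Rmin_r | apply Rmin_l]).
  assert (R3 : rho <= L * exp q / 2) by (eapply Rle_trans; [ apply Rmin_r | apply Rmin_r]).
  specialize (HB z Hz Hze ltac:(lra)).
  destruct (HL z Hz Hze) as [Q1 Q2].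
  assert (Q3 : Cmod_sq (z - e) / L < exp q).
  { rewrite Cmod_sq_alt; assert (Q := Cmod_sub_gt0 _ _ Hze).
    apply Rmult_lt_reg_r with L; [ lra | ]; unfold Rdiv; rewrite Rmult_assoc, Rinv_l by lra.
    assert (E := exp_pos q); assert (0 < L * exp q) by (apply Rmult_lt_0_compat; lra); nra. }
  assert (Q4 : ln (Cmod_sq (z - e) / L) < q) by (rewrite <- (ln_exp q); apply ln_increasing; auto).
  assert (Q5 : eps * ln (Cmod_sq (z - e) / L) < u z0 - B - gap).
  { apply Rlt_le_trans with (eps * q); [ apply Rmult_lt_compat_l; auto | ]; right; unfold q; field; lra. }
  assert (Q6 : del * Cmod_sq (z - c) <= del * (r * r)).
  { apply Rmult_le_compat_l; [ lra | ]; rewrite Cmod_sq_alt; generalize (Cmod_ge_0 (z - c)); nra. }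
  unfold u at 1; unfold gap in *; lra. }
destruct Hnear as [rho [Hrho Hnear]].
(* The maximum of [u] over the disk with a small hole at [e] lies on neither boundary, by [Hcirc]
   and [Hnear]. *)
destruct (usc_max (fun z => Cmod (z - c) <= r /\ rho <= Cmod (z - e)) (r + Cmod c) u) as [z1 [[K1 K2] Hmax]].
{ intros z [Hz _]; generalize (Cmod_triangle_rev z c); lra. }
{ intros z Hz; apply not_and_or in Hz; destruct Hz as [Hz | Hz]; apply Rnot_le_lt in Hz.
  - exists (Cmod (z - c) - r); split; [ lra | ]; intros v Hv [Hv1 _].
    generalize (Cmod_sub_triangle z v c); rewrite (Cmod_sub_sym z v); lra.
  - exists (rho - Cmod (z - e)); split; [ lra | ]; intros v Hv [_ Hv1].
    generalize (Cmod_sub_triangle v z e); lra. }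
{ intros z [Hz1 Hz2] e' He'.
  assert (Hze : z <> e) by (intros E; subst z; rewrite Cmod_sub_self in Hz2; lra).
  destruct (HL z Hz1 Hze) as [Q1 _].
  assert (Hc : rcont u z).
  { apply rcont_plus; [ apply rcont_Re, chol2_ccont; auto | apply rcont_plus].
    - apply (rcont_ext (fun v => eps * ln ((Cmod (v + - e) * Cmod (v + - e)) / L))).
      { intros v; rewrite Cmod_sq_alt; reflexivity. }
      apply (rcont_comp (fun t => eps * ln (t * t / L)) (fun v => Cmod (v + - e)%C)).
      + rewrite Cmod_sq_alt in Q1; auto_derive; auto.
      + apply rcont_Cmod, ccont_plus; [ apply ccont_id | apply ccont_const].
    - apply (rcont_ext (fun v => del * (Cmod (v + - c) * Cmod (v + - c)))).
      { intros v; rewrite Cmod_sq_alt; reflexivity. }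
      apply (rcont_comp (fun t => del * (t * t)) (fun v => Cmod (v + - c)%C)).
      + auto_derive; auto.
      + apply rcont_Cmod, ccont_plus; [ apply ccont_id | apply ccont_const]. }
  destruct (Hc e' He') as [d [D K]]; exists d; split; auto; intros v _ Hv.
  specialize (K v Hv); apply Rabs_def2 in K; lra. }
{ exists z0; split; auto; apply Rnot_lt_le; intros N; specialize (Hnear z0 Hz0 He0 ltac:(lra)); lra. }
assert (H10 : u z0 <= u z1).
{ apply Hmax; split; auto; apply Rnot_lt_le; intros N; specialize (Hnear z0 Hz0 He0 ltac:(lra)); lra. }
assert (He1 : z1 <> e) by (intros E; subst z1; rewrite Cmod_sub_self in K2; lra).
assert (K1' : Cmod (z1 - c) < r).
{ destruct K1 as [K1 | K1]; auto; specialize (Hcirc z1 K1 He1); lra. }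
assert (K2' : rho < Cmod (z1 - e)).
{ destruct K2 as [K2 | K2]; auto; specialize (Hnear z1 K1 He1 ltac:(lra)); lra. }
destruct (Hp z1 K1 He1) as [p1 [s [Hs [Hp1 [l Hl]]]]].
set (a := Re (z1 - e)); set (b := Im (z1 - e)).
assert (Hab : a * a + b * b <> 0).
{ apply Rgt_not_eq; unfold a, b; change (0 < Cmod_sq (z1 - e)); rewrite Cmod_sq_alt; nra. }
set (x := Re (z1 - c)); set (y := Im (z1 - c)).
assert (Hdir : forall dd A, Cmod dd = 1 -> second_derive (fun t => u (z1 + RtoC t * dd)%C) A -> A <= 0).
{ intros dd A Hdd HA.
  apply (second_derive_max _ A (Rmin (r - Cmod (z1 - c)) (Cmod (z1 - e) - rho)) HA).
  { apply Rmin_glb_lt; lra. }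
  intros t Ht.
  assert (T1 := Rlt_le_trans _ _ _ Ht (Rmin_l _ _)); assert (T2 := Rlt_le_trans _ _ _ Ht (Rmin_r _ _)).
  replace (z1 + RtoC 0 * dd)%C with z1 by ring.
  set (v := (z1 + RtoC t * dd)%C).
  assert (Hv : Cmod (v - z1) = Rabs t).
  { replace (v - z1)%C with (RtoC t * dd)%C by (unfold v; ring); rewrite Cmod_mult, Cmod_R, Hdd; ring. }
  apply Hmax; split.
  - generalize (Cmod_sub_triangle v z1 c); lra.
  - generalize (Cmod_sub_triangle z1 v e); rewrite (Cmod_sub_sym z1 v); lra. }
assert (HLp : 0 < L) by lra.
(* Adding the tests in the directions [1] and [Ci] cancels the two harmonic parts and leaves
   [4 * del <= 0]. *)
assert (D1 := second_derive_plus _ _ _ _ (second_derive_Re p p1 z1 1 l s Hs Hp1 Hl)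
  (second_derive_plus _ _ _ _ (second_derive_scal eps _ _ (second_derive_ln a b L HLp Hab))
    (second_derive_scal del _ _ (second_derive_sq x y)))).
apply (second_derive_ext _ (fun t => u (z1 + RtoC t * 1)%C) _ 1 Rlt_0_1) in D1.
2:{ intros t _; unfold u.
    replace (Cmod_sq (z1 + RtoC t * 1 - e)) with ((a + t) * (a + t) + b * b) by (unfold Cmod_sq, a, b; simpl; ring).
    replace (Cmod_sq (z1 + RtoC t * 1 - c)) with ((x + t) * (x + t) + y * y) by (unfold Cmod_sq, x, y; simpl; ring).
    reflexivity. }
apply (Hdir 1%C _ Cmod_1) in D1.
assert (Hba : b * b + a * a <> 0) by lra.
assert (D2 := second_derive_plus _ _ _ _ (second_derive_Re p p1 z1 Ci l s Hs Hp1 Hl)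
  (second_derive_plus _ _ _ _ (second_derive_scal eps _ _ (second_derive_ln b a L HLp Hba))
    (second_derive_scal del _ _ (second_derive_sq y x)))).
apply (second_derive_ext _ (fun t => u (z1 + RtoC t * Ci)%C) _ 1 Rlt_0_1) in D2.
2:{ intros t _; unfold u.
    replace (Cmod_sq (z1 + RtoC t * Ci - e)) with ((b + t) * (b + t) + a * a) by (unfold Cmod_sq, a, b; simpl; ring).
    replace (Cmod_sq (z1 + RtoC t * Ci - c)) with ((y + t) * (y + t) + x * x) by (unfold Cmod_sq, x, y; simpl; ring).
    reflexivity. }
apply (Hdir Ci _ Cmod_Ci) in D2.
replace (l * (Ci * Ci))%C with (- (l * (1 * 1)))%C in D2.
2:{ replace (Ci * Ci)%C with (- (1))%C by (unfold Ci; apply injective_projections; simpl; ring). ring. }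
rewrite re_opp in D2.
replace (2 * (a * a - b * b) / ((b * b + a * a) * (b * b + a * a)))
  with (- (2 * (b * b - a * a) / ((a * a + b * b) * (a * a + b * b)))) in D2 by (field; auto).
lra.
Qed.

(** A unimodular factor [k] turns the value at [z] into its modulus, and the principle for real
    parts applies to [k * p]. *)
Lemma max_modulus (p : C -> C) (c e : C) (r M B eta : R) :
  0 < eta -> 0 <= M ->
  (forall z, Cmod (z - c) <= r -> z <> e -> chol2 p z) ->
  (forall z, Cmod (z - c) <= r -> z <> e -> Cmod (z - e) < eta -> Cmod (p z) <= B) ->
  (forall z, Cmod (z - c) = r -> z <> e -> Cmod (p z) <= M) ->
  forall z, Cmod (z - c) <= r -> z <> e -> Cmod (p z) <= M.
Proof.
intros Heta HM0 Hp HB HM z Hz Hze.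
destruct (Req_dec (Cmod (p z)) 0) as [E | N].
{ lra. }
set (k := (Cconj (p z) / RtoC (Cmod (p z)))%C).
assert (Nc : RtoC (Cmod (p z)) <> RtoC 0) by (intros E; apply RtoC_inj in E; auto).
assert (Hk : Cmod k = 1).
{ unfold k; rewrite Cmod_div, Cmod_conj, Cmod_R, Rabs_pos_eq by (auto; apply Cmod_ge_0); field; auto. }
assert (Hle : forall v, Re (k * p v)%C <= Cmod (p v)).
{ intros v; eapply Rle_trans; [ apply Re_le_Cmod | ]; rewrite Cmod_mult, Hk; lra. }
replace (Cmod (p z)) with (Re (k * p z)%C).
- apply (max_principle_Re (fun v => k * p v)%C c e r M B eta); auto.
  + intros v Hv Hve; apply chol2_mult; [ apply chol2_const | auto].
  + intros v Hv Hve Hn; eapply Rle_trans; [ apply Hle | auto].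
  + intros v Hv Hve; eapply Rle_trans; [ apply Hle | auto].
- replace (k * p z)%C with (RtoC (Cmod (p z))); [ apply re_RtoC | ].
  unfold k; replace (Cconj (p z) / RtoC (Cmod (p z)) * p z)%C with ((p z * Cconj (p z)) / RtoC (Cmod (p z)))%C by (field; auto).
  rewrite <- Cmod2_conj, RtoC_pow; field; auto.
Qed.

(** * Power series *)

(** The balls of the uniform structure on [C] are boxes in the coordinates, whence the factor
    [sqrt 2]. *)
Lemma locally_Cmod (z : C) (P : C -> Prop) :
  locally z P <-> exists d, 0 < d /\ forall u, Cmod (u - z) < d -> P u.
Proof.
split.
- intros [d Hd]; exists d; split; [ apply cond_pos | ].
  intros u Hu; apply Hd; now apply C_NormedModule_mixin_compat1.
- intros [d [D H]].
  assert (D' : 0 < d / sqrt 2) by (apply Rdiv_lt_0_compat; [ auto | apply Rlt_sqrt2_0]).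
  exists (mkposreal _ D'); intros u Hu; apply H.
  apply C_NormedModule_mixin_compat2 in Hu; simpl in Hu.
  replace (sqrt 2 * (d / sqrt 2)) with d in Hu; [ exact Hu | ].
  field; apply Rgt_not_eq, Rlt_sqrt2_0.
Qed.

Lemma C_derive_cder (f : C -> C) (z l : C) : cder f z l -> C_derive f z = l.
Proof.
intros H; apply is_C_lim_unique; intros P HP.
rewrite cder_eps in H.
apply locally_Cmod in HP; destruct HP as [e [He HP]].
unfold filtermap, locally', within; apply locally_Cmod.
destruct (H (e / 2)) as [d [D K]]; [ lra | ].
exists d; split; auto; intros u Hu N; apply HP.
specialize (K u Hu); assert (P0 := Cmod_sub_gt0 _ _ N); assert (N' := Csub_ne_0 _ _ N).
replace (f u - f z - l * (u - z))%C with (((f u - f z) / (u - z) - l) * (u - z))%C in K by (field; auto).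
rewrite Cmod_mult in K; apply Rmult_le_reg_r in K; auto; lra.
Qed.

Fixpoint psum (a : nat -> C) (x : C) (n : nat) : C :=
  match n with
  | O => a O
  | S k => (psum a x k + x ^ (S k) * a (S k))%C
  end.

Lemma pow_n_Cpow (x : C) (n : nat) : @pow_n C_AbsRing x n = (x ^ n)%C.
Proof. induction n as [ | n IH]; simpl; [ reflexivity | now rewrite IH]. Qed.

Lemma sum_n_psum (a : nat -> C) (x : C) (n : nat) :
  sum_n (fun k => @scal C_AbsRing C_NormedModule (pow_n x k) (a k)) n = psum a x n.
Proof.
induction n as [ | n IH].
- rewrite sum_O; apply (scal_one (V := C_NormedModule)).
- rewrite sum_Sn, IH, pow_n_Cpow; reflexivity.
Qed.

Lemma is_pseries_psum (a : nat -> C) (x l : C) :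
  @is_pseries C_AbsRing C_NormedModule a x l <->
  forall e, 0 < e -> exists N, forall n, (N <= n)%nat -> Cmod (psum a x n - l) < e.
Proof.
unfold is_pseries, is_series; split.
- intros H e He.
  assert (L : locally (T := C_UniformSpace) l (fun u => Cmod (u - l) < e)).
  { apply (locally_Cmod l); exists e; auto. }
  destruct (H _ L) as [N HN]; exists N; intros n Hn.
  rewrite <- sum_n_psum; apply HN, Hn.
- intros H P HP; apply (locally_Cmod l) in HP; destruct HP as [e [He HP]].
  destruct (H e He) as [N HN]; exists N; intros n Hn; apply HP.
  rewrite sum_n_psum; auto.
Qed.

Definition dcoef (a : nat -> C) (n : nat) : C := (RtoC (INR (S n)) * a (S n))%C.

(** Raising the exponent by one multiplies the remainder by [y] and adds
    [(n + 2) x^(n+1) (y - x)^2]. The constant [(n + 1) (n + 2)] is the one that differentiating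
    twice produces, so the bounds add up to a twice derived series. *)
Lemma pow_taylor_bound (x y : C) (rho : R) (n : nat) :
  Cmod x <= rho -> Cmod y <= rho ->
  Cmod (y ^ S (S n) - x ^ S (S n) - RtoC (INR (S (S n))) * x ^ S n * (y - x)) <=
  INR (S n) * INR (S (S n)) * rho ^ n * (Cmod (y - x) * Cmod (y - x)).
Proof.
intros Hx Hy; assert (Hr : 0 <= rho) by (generalize (Cmod_ge_0 x); lra).
induction n as [ | n IH].
- replace (y ^ 2 - x ^ 2 - RtoC (INR 2) * x ^ 1 * (y - x))%C with ((y - x) * (y - x))%C.
  + rewrite Cmod_mult; simpl; generalize (Cmod_ge_0 (y - x)); nra.
  + replace (RtoC (INR 2)) with (1 + 1)%C by (rewrite <- RtoC_plus; reflexivity). ring.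
- set (h := (y - x)%C) in *.
  replace (y ^ S (S (S n)) - x ^ S (S (S n)) - RtoC (INR (S (S (S n)))) * x ^ S (S n) * h)%C
    with (y * (y ^ S (S n) - x ^ S (S n) - RtoC (INR (S (S n))) * x ^ S n * h)
          + RtoC (INR (S (S n))) * x ^ S n * (h * h))%C.
  2:{ rewrite (S_INR (S (S n))), RtoC_plus; unfold h; rewrite !Cpow_S; ring. }
  eapply Rle_trans; [ apply Cmod_triangle | ].
  rewrite !Cmod_mult, Cmod_pow, Cmod_R, (Rabs_pos_eq (INR _)) by apply pos_INR.
  assert (Hp : 0 <= rho ^ n) by (apply pow_le; auto).
  assert (H1 : Cmod x ^ S n <= rho ^ S n) by (apply pow_incr; split; auto; apply Cmod_ge_0).
  assert (Hh := Cmod_ge_0 h).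
  set (A := INR (S (S n))) in *.
  assert (E : INR (S (S (S n))) = A + 1) by (unfold A; rewrite S_INR; reflexivity).
  assert (E' : INR (S n) = A - 1) by (unfold A; rewrite (S_INR (S n)); ring).
  assert (HA : 0 <= A) by apply pos_INR.
  rewrite E; rewrite E' in IH.
  assert (T1 : Cmod y * Cmod (y ^ S (S n) - x ^ S (S n) - RtoC A * x ^ S n * h) <=
    rho * ((A - 1) * A * rho ^ n * (Cmod h * Cmod h))).
  { apply Rmult_le_compat; auto; apply Cmod_ge_0. }
  assert (Hhh : 0 <= Cmod h * Cmod h) by nra.
  assert (T2 : A * Cmod x ^ S n * (Cmod h * Cmod h) <= A * rho ^ S n * (Cmod h * Cmod h)).
  { apply Rmult_le_compat_r; auto; apply Rmult_le_compat_l; auto. }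
  simpl pow in *.
  assert (0 <= A * (rho * rho ^ n) * (Cmod h * Cmod h)).
  { repeat apply Rmult_le_pos; auto. }
  nra.
Qed.

(** The truncation indices drop by one with each differentiation, as the degrees do. *)
Lemma psum_taylor_bound (a : nat -> C) (x y : C) (rho : R) (n : nat) :
  Cmod x <= rho -> Cmod y <= rho ->
  Cmod (psum a y (S (S n)) - psum a x (S (S n)) - psum (dcoef a) x (S n) * (y - x)) <=
  sum_n (fun k => PS_derive (PS_derive (fun j => Cmod (a j))) k * rho ^ k) n * (Cmod (y - x) * Cmod (y - x)).
Proof.
intros Hx Hy.
assert (Hstep : forall n, 
  Cmod (a (S (S n)) * (y ^ S (S n) - x ^ S (S n) - RtoC (INR (S (S n))) * x ^ S n * (y - x))) <=
  PS_derive (PS_derive (fun j => Cmod (a j))) n * rho ^ n * (Cmod (y - x) * Cmod (y - x))).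
{ intros m; rewrite Cmod_mult; unfold PS_derive.
  generalize (pow_taylor_bound x y rho m Hx Hy) (Cmod_ge_0 (a (S (S m)))).
  intros H1 H2; eapply Rle_trans; [ apply Rmult_le_compat_l; [ exact H2 | exact H1] | ].
  right; ring. }
induction n as [ | n IH].
- rewrite sum_O.
  eapply Rle_trans; [ | apply (Hstep 0%nat)]; right; f_equal.
  unfold dcoef, psum; simpl INR; rewrite !RtoC_plus; ring.
- rewrite sum_Sn; change plus with Rplus; rewrite Rmult_plus_distr_r.
  eapply Rle_trans; [ | apply Rplus_le_compat; [ exact IH | exact (Hstep (S n))]].
  eapply Rle_trans; [ | apply Cmod_triangle]; right; f_equal.
  change (psum a y (S (S (S n)))) with (psum a y (S (S n)) + y ^ S (S (S n)) * a (S (S (S n))))%C.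
  change (psum a x (S (S (S n)))) with (psum a x (S (S n)) + x ^ S (S (S n)) * a (S (S (S n))))%C.
  change (psum (dcoef a) x (S (S n))) with (psum (dcoef a) x (S n) + x ^ S (S n) * (RtoC (INR (S (S (S n)))) * a (S (S (S n)))))%C.
  ring.
Qed.

Lemma sum_n_le_Series (u : nat -> R) (n : nat) :
  (forall k, 0 <= u k) -> ex_series u -> sum_n u n <= Series u.
Proof.
intros Hu Hex.
assert (H := Series_correct _ Hex).
apply (is_lim_seq_incr_compare (sum_n u) (Series u)); [ exact H | ].
intros k; rewrite sum_Sn; change plus with Rplus; specialize (Hu (S k)); lra.
Qed.

(** The terms of a convergent series are bounded, and this bounds the radius of the series of moduli
    from below. The theory of real radii of convergence thereby applies to complex series. *)
Lemma psum_CV_radius (a : nat -> C) (x l : C) :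
  @is_pseries C_AbsRing C_NormedModule a x l ->
  Rbar_le (Cmod x) (CV_radius (fun j => Cmod (a j))).
Proof.
intros H.
apply (proj1 (CV_radius_bounded (fun j => Cmod (a j)))).
rewrite is_pseries_psum in H.
destruct (H 1 Rlt_0_1) as [N HN].
assert (HB : exists M, forall n, (n <= N)%nat -> Cmod (x ^ n * a n) <= M).
{ clear HN; induction N as [ | N [M HM]].
  - exists (Cmod (x ^ 0 * a 0%nat)); intros n Hn; replace n with 0%nat by lia; lra.
  - exists (Rmax M (Cmod (x ^ S N * a (S N)))); intros n Hn.
    destruct (Nat.eq_dec n (S N)) as [-> | Hne]; [ apply Rmax_r | ].
    eapply Rle_trans; [ apply HM; lia | apply Rmax_l]. }
destruct HB as [M HM].
(* Past [N], a term is the difference of two partial sums within 1 of the limit, hence the 2. *)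
exists (Rmax M 2); intros n.
replace (Cmod (a n) * Cmod x ^ n) with (Cmod (x ^ n * a n)).
2:{ rewrite Cmod_mult, Cmod_pow; ring. }
rewrite Rabs_pos_eq by apply Cmod_ge_0.
destruct (Nat.le_gt_cases n N) as [Hn | Hn]; [ eapply Rle_trans; [ now apply HM | apply Rmax_l] | ].
eapply Rle_trans; [ | apply Rmax_r].
destruct n as [ | n]; [ lia | ].
assert (H1 := HN (S n) ltac:(lia)); assert (H2 := HN n ltac:(lia)).
replace (x ^ S n * a (S n))%C with ((psum a x (S n) - l) - (psum a x n - l))%C by (simpl; ring).
eapply Rle_trans; [ apply Cmod_triangle | ]; rewrite Cmod_opp; lra.
Qed.

Lemma dcoef_pseries (a : nat -> C) (x : C) :
  Rbar_lt (Cmod x) (CV_radius (fun j => Cmod (a j))) ->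
  exists l, @is_pseries C_AbsRing C_NormedModule (dcoef a) x l.
Proof.
intros H.
assert (Hex : @ex_series C_AbsRing C_CompleteNormedModule (fun k => scal (pow_n x k) (dcoef a k : C_NormedModule))).
{ apply (ex_series_le (K := C_AbsRing) _ (fun n => Rabs (PS_derive (fun j => Cmod (a j)) n * Cmod x ^ n))).
  - intros n; rewrite pow_n_Cpow; change (Cmod (x ^ n * dcoef a n)%C <= Rabs (PS_derive (fun j => Cmod (a j)) n * Cmod x ^ n)); right.
    rewrite Cmod_mult, Cmod_pow; unfold dcoef, PS_derive.
    rewrite Cmod_mult, Cmod_R, !Rabs_mult, (Rabs_pos_eq (Cmod _)), (Rabs_pos_eq (_ ^ _)); try apply Cmod_ge_0.
    + ring.
    + apply pow_le, Cmod_ge_0.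
  - apply CV_disk_inside; rewrite CV_radius_derive, Rabs_pos_eq; auto; apply Cmod_ge_0. }
destruct Hex as [l Hl]; exists l; exact Hl.
Qed.

(** The bound for partial sums passes to the limit; [K] is the twice derived series of the moduli at
    [rho], which converges because differentiation preserves the radius. *)
Lemma pseries_quadratic_remainder (a : nat -> C) (rho : R) :
  0 <= rho -> Rbar_lt rho (CV_radius (fun j => Cmod (a j))) ->
  exists K, 0 <= K /\ forall x y lx ly l1 : C, Cmod x <= rho -> Cmod y <= rho ->
    @is_pseries C_AbsRing C_NormedModule a x lx ->
    @is_pseries C_AbsRing C_NormedModule a y ly ->
    @is_pseries C_AbsRing C_NormedModule (dcoef a) x l1 ->
    Cmod (ly - lx - l1 * (y - x)) <= K * (Cmod (y - x) * Cmod (y - x)).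
Proof.
intros Hr HR.
set (u k := PS_derive (PS_derive (fun j => Cmod (a j))) k * rho ^ k).
assert (Hu : forall k, 0 <= u k).
{ intros k; unfold u, PS_derive; repeat apply Rmult_le_pos; try apply pos_INR; try apply Cmod_ge_0.
  now apply pow_le. }
assert (Hex : ex_series u).
{ apply ex_series_Rabs, CV_disk_inside; rewrite !CV_radius_derive, Rabs_pos_eq; auto. }
exists (Series u); split.
{ eapply Rle_trans; [ apply (Hu 0%nat) | ]; rewrite <- (sum_O u); apply sum_n_le_Series; auto. }
intros x y lx ly l1 Hx Hy Px Py P1.
rewrite is_pseries_psum in Px, Py, P1.
apply Rnot_lt_le; intros N.
set (h := (y - x)%C) in *.
(* [g] is the supposed excess; three truncation errors of at most [g / 4] cannot account for it. *)
set (g := Cmod (ly - lx - l1 * h) - Series u * (Cmod h * Cmod h)).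
assert (Hg : 0 < g) by (unfold g; lra).
assert (Hh := Cmod_ge_0 h).
destruct (Px (g / 4)) as [N1 H1]; [ lra | ].
destruct (Py (g / 4)) as [N2 H2]; [ lra | ].
destruct (P1 (g / (4 * (Cmod h + 1)))) as [N3 H3]; [ apply Rdiv_lt_0_compat; lra | ].
set (n := (N1 + N2 + N3)%nat).
assert (T := psum_taylor_bound a x y rho n Hx Hy); fold h u in T.
specialize (H1 (S (S n)) ltac:(lia)); specialize (H2 (S (S n)) ltac:(lia)); specialize (H3 (S n) ltac:(lia)).
assert (T' : sum_n u n * (Cmod h * Cmod h) <= Series u * (Cmod h * Cmod h)).
{ apply Rmult_le_compat_r; [ nra | apply sum_n_le_Series; auto]. }
set (X := psum a x (S (S n))) in *; set (Y := psum a y (S (S n))) in *; set (Z := psum (dcoef a) x (S n)) in *.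
assert (H3' : Cmod ((Z - l1) * h) <= g / 4).
{ rewrite Cmod_mult; apply Rle_trans with (g / (4 * (Cmod h + 1)) * (Cmod h + 1)).
  - apply Rmult_le_compat; try apply Cmod_ge_0; lra.
  - right; field; lra. }
assert (Hfin : Cmod (ly - lx - l1 * h) <= Cmod (Y - X - Z * h) + Cmod (Y - ly) + Cmod (X - lx) + Cmod ((Z - l1) * h)).
{ replace (ly - lx - l1 * h)%C with ((Y - X - Z * h) + - (Y - ly) + (X - lx) + (Z - l1) * h)%C by ring.
  do 2 (eapply Rle_trans; [ apply Cmod_triangle | apply Rplus_le_compat_r]).
  eapply Rle_trans; [ apply Cmod_triangle | ]; rewrite Cmod_opp; lra. }
unfold g in *; lra.
Qed.

(** The derived series about the same centre is the derivative on the whole ball, with no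
    re-expansion at other points. So the derivative is again analytic at [z0] and the lemma can be
    iterated. *)
Lemma analytic_at_cder (f : C -> C) (z0 : C) :
  analytic_at f z0 ->
  exists f1 r, 0 < r /\ (forall z, Cmod (z - z0) < r -> cder f z (f1 z)) /\ analytic_at f1 z0.
Proof.
intros [a [r [Hr H]]].
assert (HCV : forall rho, 0 <= rho < r -> Rbar_lt rho (CV_radius (fun j => Cmod (a j)))).
(* Convergence at one point bounds the radius only non-strictly, so a point beyond [rho] is used. *)
{ intros rho Hrho; set (s := (rho + r) / 2).
  apply Rbar_lt_le_trans with s; [ unfold s; simpl; lra | ].
  assert (Hs : Cmod (z0 + RtoC s - z0) = s).
  { replace (z0 + RtoC s - z0)%C with (RtoC s) by ring; rewrite Cmod_R, Rabs_pos_eq; unfold s; lra. }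
  rewrite <- Hs; eapply psum_CV_radius, H; rewrite Hs; unfold s; lra. }
set (f1 z := epsilon (inhabits (RtoC 0)) (fun l => @is_pseries C_AbsRing C_NormedModule (dcoef a) (z - z0)%C l)).
assert (Hf1 : forall z, Cmod (z - z0) < r -> @is_pseries C_AbsRing C_NormedModule (dcoef a) (z - z0)%C (f1 z)).
{ intros z Hz; unfold f1; apply epsilon_spec, dcoef_pseries, HCV; split; [ apply Cmod_ge_0 | auto]. }
exists f1, r; split; [ auto | split]; [ | exists (dcoef a), r; auto].
intros z Hz; apply cder_eps; intros e He.
set (rho := (Cmod (z - z0) + r) / 2).
assert (P := Cmod_ge_0 (z - z0)).
destruct (pseries_quadratic_remainder a rho) as [K [HK Hq]]; [ unfold rho; lra | apply HCV; unfold rho; lra | ].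
exists (Rmin (r - rho) (e / (K + 1))); split.
{ apply Rmin_glb_lt; [ unfold rho; lra | apply Rdiv_lt_0_compat; lra]. }
intros u Hu.
assert (U1 := Rlt_le_trans _ _ _ Hu (Rmin_l _ _)); assert (U2 := Rlt_le_trans _ _ _ Hu (Rmin_r _ _)).
assert (Hu0 : Cmod (u - z0) <= rho) by (generalize (Cmod_sub_triangle u z z0); unfold rho in *; lra).
assert (Q := Hq (z - z0)%C (u - z0)%C (f z) (f u) (f1 z) ltac:(unfold rho; lra) Hu0
  (H z Hz) (H u ltac:(unfold rho in *; lra)) (Hf1 z Hz)).
replace (u - z0 - (z - z0))%C with (u - z)%C in Q by ring.
eapply Rle_trans; [ exact Q | ]; rewrite <- Rmult_assoc; apply Rmult_le_compat_r; [ apply Cmod_ge_0 | ].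
apply Rle_trans with ((K + 1) * (e / (K + 1))).
- apply Rmult_le_compat; try lra; apply Cmod_ge_0.
- right; field; lra.
Qed.

Lemma analytic_on_C_derive (D : C -> Prop) (f : C -> C) :
  (forall z, D z -> exists r, 0 < r /\ forall u, Cmod (u - z) < r -> D u) ->
  analytic_on D f ->
  (forall z, D z -> cder f z (C_derive f z)) /\ analytic_on D (C_derive f).
Proof.
intros HD Hf; split.
- intros z Dz; destruct (analytic_at_cder f z (Hf z Dz)) as [f1 [r [Hr [H1 _]]]].
  assert (H := H1 z ltac:(rewrite Cmod_sub_self; auto)).
  now rewrite (C_derive_cder _ _ _ H).
- intros z Dz; destruct (analytic_at_cder f z (Hf z Dz)) as [f1 [r [Hr [H1 [a [s [Hs Ha]]]]]]].
  exists a, (Rmin r s); split; [ now apply Rmin_glb_lt | ].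
  intros u Hu; rewrite (C_derive_cder f u (f1 u)).
  + apply Ha; eapply Rlt_le_trans; [ exact Hu | apply Rmin_r].
  + apply H1; eapply Rlt_le_trans; [ exact Hu | apply Rmin_l].
Qed.

(** * Injective functions on the disk *)

Lemma disk_open (z : C) : disk z -> exists r, 0 < r /\ forall u, Cmod (u - z) < r -> disk u.
Proof.
unfold disk; intros Dz; exists (1 - Cmod z); split; [ lra | ].
intros u Hu; generalize (Cmod_triangle_rev u z); lra.
Qed.

Lemma analytic_chol2 (f : C -> C) : analytic_on disk f -> forall z, disk z -> chol2 f z.
Proof.
intros Hf z Dz.
destruct (analytic_on_C_derive disk f disk_open Hf) as [H1 Hf1].
destruct (analytic_on_C_derive disk (C_derive f) disk_open Hf1) as [H2 _].
destruct (disk_open z Dz) as [r [Hr Hu]].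
exists (C_derive f), r; split; [ auto | split; [ auto | ]].
exists (C_derive (C_derive f) z); auto.
Qed.

Lemma compact_avoids (K : C -> Prop) (B : R) (g : C -> C) (v : C) :
  (forall z, K z -> Cmod z <= B) ->
  (forall z, ~ K z -> exists d, 0 < d /\ forall u, Cmod (u - z) < d -> ~ K u) ->
  (forall z, K z -> ccont g z) ->
  (forall z, K z -> g z <> v) ->
  exists d, 0 < d /\ forall z, K z -> d <= Cmod (g z - v).
Proof.
intros HB Hcl Hg Hv.
destruct (compact_uniform K B (fun d z => d <= Cmod (g z - v))) as [d Hd]; eauto.
- intros; lra.
- intros z Kz; assert (P := Cmod_sub_gt0 _ _ (Hv z Kz)).
  destruct (Hg z Kz (Cmod (g z - v) / 2)) as [d [D H]]; [ lra | ].
  exists (Rmin d (Cmod (g z - v) / 2)); split; [ apply Rmin_glb_lt; lra | ].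
  intros u _ Hu; specialize (H u (Rlt_le_trans _ _ _ Hu (Rmin_l _ _))).
  generalize (Rmin_r d (Cmod (g z - v) / 2)) (Cmod_sub_triangle (g z) (g u) v).
  rewrite (Cmod_sub_sym (g z) (g u)); lra.
Qed.

Lemma circle_avoids (g : C -> C) (c v : C) (r : R) :
  (forall z, Cmod (z - c) = r -> ccont g z) ->
  (forall z, Cmod (z - c) = r -> g z <> v) ->
  exists d, 0 < d /\ forall z, Cmod (z - c) = r -> d <= Cmod (g z - v).
Proof.
intros Hg Hv; apply (compact_avoids (fun z => Cmod (z - c) = r) (r + Cmod c)); auto.
- intros z Hz; generalize (Cmod_triangle_rev z c); lra.
- intros z Hz; exists (Rabs (Cmod (z - c) - r)); split.
  + apply Rabs_pos_lt; lra.
  + intros u Hu E.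
    generalize (Cmod_sub_triangle z u c) (Cmod_sub_triangle u z c); rewrite (Cmod_sub_sym z u).
    intros A1 A2; revert Hu; apply Rle_not_lt, Rabs_le; lra.
Qed.

(** If [v] is omitted on the closed disk, [/ (f - v)] obeys the maximum principle there; but it is
    at most [2 / d] on the circle, where [f] stays [d] away from [f z0], and larger than that at the
    centre. *)
Lemma injective_open (f : C -> C) (z0 : C) (rho : R) :
  (forall z, disk z -> chol2 f z) -> injective_on disk f ->
  0 < rho -> Cmod z0 + rho < 1 ->
  exists e, 0 < e /\ forall v, Cmod (v - f z0) < e -> exists z, Cmod (z - z0) < rho /\ f z = v.
Proof.
intros Hf Hinj Hr Hz0.
assert (HD : forall z, Cmod (z - z0) <= rho -> disk z).
{ intros z Hz; unfold disk; generalize (Cmod_triangle_rev z z0); lra. }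
assert (D0 : disk z0) by (apply HD; rewrite Cmod_sub_self; lra).
destruct (circle_avoids f z0 (f z0) rho) as [d [D Hd]].
{ intros z Hz; apply chol2_ccont, Hf, HD; lra. }
{ intros z Hz E; apply Hinj in E; auto; [ | apply HD; lra].
  subst z; rewrite Cmod_sub_self in Hz; lra. }
exists (d / 2); split; [ lra | ]; intros v Hv; apply NNPP; intros N.
assert (Hne : forall z, Cmod (z - z0) <= rho -> f z <> v).
{ intros z [Hz | Hz] E; [ apply N; eauto | ].
  specialize (Hd z Hz); rewrite E in Hd; lra. }
assert (Hne' : forall z, Cmod (z - z0) <= rho -> (f z + - v)%C <> RtoC 0).
{ intros z Hz; apply (Csub_ne_0 (f z) v), Hne, Hz. }
(* There is no singularity here, so the exceptional point is put outside the disk, farther than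
   [rho] from it or at that distance; the clause on its neighbourhood is then vacuous. *)
assert (Hrz : Cmod (z0 + RtoC (2 * rho) - z0) = 2 * rho).
{ replace (z0 + RtoC (2 * rho) - z0)%C with (RtoC (2 * rho)) by ring; rewrite Cmod_R, Rabs_pos_eq; lra. }
assert (Hmax := max_modulus (fun z => / (f z + - v))%C z0 (z0 + RtoC (2 * rho)) rho (2 / d) 0 rho Hr).
assert (Hfin : Cmod (/ (f z0 + - v)) <= 2 / d).
{ apply Hmax.
  - left; apply Rdiv_lt_0_compat; lra.
  - intros z Hz _; apply chol2_inv; auto; apply chol2_plus; [ apply Hf; auto | apply chol2_const].
  - intros z Hz _ Hn; generalize (Cmod_sub_triangle (z0 + RtoC (2 * rho)) z z0).
    rewrite (Cmod_sub_sym _ z), Hrz; lra.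
  - intros z Hz _; rewrite Cmod_inv by (apply Hne'; lra).
    replace (2 / d) with (/ (d / 2)) by (field; lra); apply Rinv_le_contravar; [ lra | ].
    specialize (Hd z Hz); generalize (Cmod_sub_triangle (f z) v (f z0)); unfold Cminus at 2; lra.
  - rewrite Cmod_sub_self; lra.
  - intros E; rewrite <- E, Cmod_sub_self in Hrz; lra. }
rewrite Cmod_inv in Hfin by (apply Hne'; rewrite Cmod_sub_self; lra).
assert (Q : 0 < Cmod (f z0 + - v)) by (apply Cmod_gt_0, Hne'; rewrite Cmod_sub_self; lra).
assert (Q' : Cmod (f z0 + - v) < d / 2) by (rewrite Cmod_sub_sym in Hv; exact Hv).
apply Rle_not_lt in Hfin; apply Hfin.
replace (2 / d) with (/ (d / 2)) by (field; lra); apply Rinv_lt_contravar; auto.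
apply Rmult_lt_0_compat; lra.
Qed.

Lemma Im_Re (a : C) : Im a = Re (- Ci * a)%C.
Proof. unfold Re, Im; simpl; ring. Qed.

(** The mean value theorem is available for real parts only; it is applied to [g] and to [- Ci * g],
    and the factor 2 adds the two estimates. *)
Lemma cder_segment_bound (g g1 : C -> C) (z0 z : C) (k : R) :
  (forall t, 0 <= t <= 1 -> cder g (z0 + RtoC t * (z - z0))%C (g1 (z0 + RtoC t * (z - z0))%C)) ->
  (forall t, 0 <= t <= 1 -> Cmod (g1 (z0 + RtoC t * (z - z0))%C) <= k) ->
  Cmod (g z - g z0) <= 2 * (k * Cmod (z - z0)).
Proof.
intros Hg Hk; set (h := (z - z0)%C) in *.
assert (HR : forall c, Cmod c = 1 -> Rabs (Re (c * (g z - g z0))%C) <= k * Cmod h).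
{ intros c Hc.
  destruct (MVT_cor2 (fun t => Re (c * g (z0 + RtoC t * h))%C) (fun t => Re (c * g1 (z0 + RtoC t * h) * h)%C) 0 1 Rlt_0_1) as [t [Et Ht]].
  { intros t Ht; apply is_derive_Reals, (cder_line (fun u => c * g u)%C).
    apply cder_value with (0 * g (z0 + RtoC t * h) + c * g1 (z0 + RtoC t * h))%C; [ ring | ].
    apply cder_mult; [ apply cder_const | auto]. }
  replace (Re (c * (g z - g z0))%C) with (Re (c * g1 (z0 + RtoC t * h) * h)%C).
  - eapply Rle_trans; [ apply re_le_Cmod | ]; rewrite !Cmod_mult, Hc, Rmult_1_l.
    apply Rmult_le_compat_r; [ apply Cmod_ge_0 | apply Hk; lra].
  - rewrite Rminus_0_r, Rmult_1_r in Et; rewrite <- Et.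
    replace (z0 + RtoC 1 * h)%C with z by (unfold h; ring).
    replace (z0 + RtoC 0 * h)%C with z0 by (unfold h; ring).
    replace (c * (g z - g z0))%C with (c * g z + - (c * g z0))%C by ring.
    rewrite re_plus, re_opp; reflexivity. }
eapply Rle_trans; [ apply Cmod_le_Re_Im | ].
assert (H1 := HR 1%C Cmod_1); rewrite Cmult_1_l in H1.
assert (H2 := HR (- Ci)%C ltac:(rewrite Cmod_opp; apply Cmod_Ci)); rewrite <- Im_Re in H2; lra.
Qed.

(* If [f'(z0) = 0], the divided difference [(f z - f z1) / (z - z1)] is small at [z0]
   but not on a circle around [z0], so it vanishes inside; injectivity then forces
   [f'(z1) = 0] for all [z1] near [z0]. *)
Lemma injective_cder_ne_0 (f f1 : C -> C) (z0 : C) :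
  (forall z, disk z -> chol2 f z) -> (forall z, disk z -> cder f z (f1 z)) ->
  injective_on disk f -> disk z0 -> f1 z0 <> RtoC 0.
Proof.
intros Hf Hf1 Hinj D0 E0.
set (rho := (1 - Cmod z0) / 2).
assert (Hr : 0 < rho) by (unfold rho, disk in *; lra).
assert (HD : forall z, Cmod (z - z0) <= rho -> disk z).
{ intros z Hz; unfold disk in *; generalize (Cmod_triangle_rev z z0); unfold rho in *; lra. }
destruct (circle_avoids f z0 (f z0) rho) as [d [D Hd]].
{ intros z Hz; apply chol2_ccont, Hf, HD; lra. }
{ intros z Hz E; apply Hinj in E; auto; [ | apply HD; lra].
  subst z; rewrite Cmod_sub_self in Hz; lra. }
destruct (chol2_ccont f z0 (Hf z0 D0) (d / 2)) as [r1 [R1 H1]]; [ lra | ].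
(* Multiplied by the bound [4 * rho / d] for the reciprocal divided difference, this gives the
   contradictory factor 1/2. *)
assert (Hq : 0 < d / (8 * rho)) by (apply Rdiv_lt_0_compat; lra).
destruct (proj1 (cder_eps _ _ _) (Hf1 z0 D0) _ Hq) as [r2 [R2 H2]].
set (r := Rmin rho (Rmin r1 r2)).
assert (Rr : 0 < r) by (unfold r; repeat apply Rmin_glb_lt; auto).
assert (Hr1 : r <= rho) by apply Rmin_l.
assert (Hr2 : r <= r1) by (eapply Rle_trans; [ apply Rmin_r | apply Rmin_l]).
assert (Hr3 : r <= r2) by (eapply Rle_trans; [ apply Rmin_r | apply Rmin_r]).
assert (Hz : forall z1, Cmod (z1 - z0) < r -> f1 z1 = 0).
{ intros z1 Hz1; apply NNPP; intros N1.
  destruct (classic (z1 = z0)) as [-> | Hne]; [ now apply N1 | ].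
  assert (D1 : disk z1) by (apply HD; lra).
  assert (Hfne : forall z, Cmod (z - z0) <= rho -> z <> z1 -> (f z + - f z1)%C <> RtoC 0).
  { intros z Hz Hzz; apply (Csub_ne_0 (f z) (f z1)); intros E; apply Hinj in E; auto. }
  destruct (Hf1 z1 D1) as [phi [Pc [P1 Pf]]].
  (* The reciprocal of the divided difference is bounded near its only exceptional point [z1],
     because [phi z1 = f1 z1] is nonzero. *)
  assert (Pinv := ccont_inv phi z1 Pc ltac:(now rewrite P1)).
  destruct (ccont_bounded _ _ Pinv) as [eta [Heta Hb]].
  assert (Hmax := max_modulus (fun z => (z + - z1) * / (f z + - f z1))%C z0 z1 rho (4 * rho / d)
    (Cmod (/ phi z1) + 1) eta Heta).
  assert (Hfin : Cmod ((z0 + - z1) * / (f z0 + - f z1)) <= 4 * rho / d).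
  { apply Hmax; auto.
    - left; apply Rdiv_lt_0_compat; lra.
    - intros z Hz Hzz; apply chol2_mult.
      + apply chol2_plus; [ apply chol2_id | apply chol2_const].
      + apply chol2_inv; auto; apply chol2_plus; [ apply Hf; auto | apply chol2_const].
    - intros z Hz Hzz Hn.
      replace ((z + - z1) * / (f z + - f z1))%C with (/ phi z)%C; [ now apply Hb | ].
      specialize (Hfne z Hz Hzz); rewrite (Pf z) in Hfne |- *.
      assert (phi z <> 0) by (intros E; apply Hfne; rewrite E; ring).
      assert (z - z1 <> 0)%C by now apply Csub_ne_0.
      replace (f z1 + phi z * (z - z1) + - f z1)%C with (phi z * (z - z1))%C by ring.
      change (z + - z1)%C with (z - z1)%C; field; auto.
    - intros z Hz Hzz; rewrite Cmod_mult, Cmod_inv by (apply Hfne; auto; lra).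
      specialize (Hd z Hz); specialize (H1 z1 ltac:(lra)).
      assert (A1 : d / 2 <= Cmod (f z + - f z1)).
      { generalize (Cmod_sub_triangle (f z) (f z1) (f z0)); unfold Cminus at 2; lra. }
      assert (A2 : Cmod (z + - z1) <= 2 * rho).
      { generalize (Cmod_sub_triangle z z0 z1); rewrite (Cmod_sub_sym z0 z1); unfold Cminus at 1; lra. }
      replace (4 * rho / d) with (2 * rho * / (d / 2)) by (field; lra).
      apply Rmult_le_compat; auto; [ apply Cmod_ge_0 | left; apply Rinv_0_lt_compat; lra | ].
      apply Rinv_le_contravar; lra.
    - rewrite Cmod_sub_self; lra. }
  specialize (H2 z1 ltac:(lra)); rewrite E0 in H2.
  replace (f z1 - f z0 - 0 * (z1 - z0))%C with (f z1 - f z0)%C in H2 by ring.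
  assert (F0 := Hfne z0 ltac:(rewrite Cmod_sub_self; lra) ltac:(auto)).
  rewrite Cmod_mult, Cmod_inv in Hfin by auto.
  assert (Q := proj1 (Cmod_gt_0 _) F0).
  assert (S1 : Cmod (f z0 + - f z1) = Cmod (f z1 - f z0)) by apply Cmod_sub_sym.
  assert (S2 : Cmod (z0 + - z1) = Cmod (z1 - z0)) by apply Cmod_sub_sym.
  rewrite S1 in *; rewrite S2 in *.
  assert (Hfin' : Cmod (z1 - z0) <= 4 * rho / d * Cmod (f z1 - f z0)).
  { apply Rmult_le_reg_r with (/ Cmod (f z1 - f z0)); [ now apply Rinv_0_lt_compat | ].
    rewrite Rmult_assoc, Rinv_r, Rmult_1_r by lra; exact Hfin. }
  assert (Hc : 4 * rho / d * Cmod (f z1 - f z0) <= / 2 * Cmod (z1 - z0)).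
  { replace (/ 2 * Cmod (z1 - z0)) with (4 * rho / d * (d / (8 * rho) * Cmod (z1 - z0))) by (field; lra).
    apply Rmult_le_compat_l; auto; left; apply Rdiv_lt_0_compat; lra. }
  assert (Q' := Cmod_sub_gt0 _ _ Hne); lra. }
(* A derivative that vanishes near [z0] makes [f] constant there, against injectivity. *)
set (z1 := (z0 + RtoC (r / 2))%C).
assert (Ez : (z1 - z0)%C = RtoC (r / 2)) by (unfold z1; ring).
assert (Hz1 : Cmod (z1 - z0) = r / 2) by (rewrite Ez, Cmod_R, Rabs_pos_eq; lra).
assert (Hb := cder_segment_bound f f1 z0 z1 0).
assert (Hseg : forall t, 0 <= t <= 1 -> Cmod (z0 + RtoC t * (z1 - z0) - z0) < r).
{ intros t Ht; replace (z0 + RtoC t * (z1 - z0) - z0)%C with (RtoC t * (z1 - z0))%C by ring.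
  rewrite Cmod_mult, Cmod_R, Rabs_pos_eq, Hz1 by lra; nra. }
assert (Hbd : Cmod (f z1 - f z0) <= 2 * (0 * Cmod (z1 - z0))).
{ apply Hb; intros t Ht; specialize (Hseg t Ht).
  - apply Hf1, HD; lra.
  - rewrite Hz by auto; rewrite Cmod_0; lra. }
assert (Ef : f z1 = f z0).
{ replace (f z1) with ((f z1 - f z0) + f z0)%C by ring.
  rewrite (Cmod_eq_0 (f z1 - f z0)); [ ring | ]; generalize (Cmod_ge_0 (f z1 - f z0)); lra. }
apply Hinj in Ef; auto; [ | apply HD; lra].
rewrite Ef, Cmod_sub_self in Hz1; lra.
Qed.

(** * The inverse function on the image *)

Definition disk_inverse (f : C -> C) (v : C) : C :=
  epsilon (inhabits (RtoC 0)) (fun z => disk z /\ f z = v).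

Lemma disk_inverse_spec (f : C -> C) (v : C) :
  image f disk v -> disk (disk_inverse f v) /\ f (disk_inverse f v) = v.
Proof. intros H; unfold disk_inverse; apply epsilon_spec; exact H. Qed.

Lemma disk_inverse_f (f : C -> C) (z : C) : injective_on disk f -> disk z -> disk_inverse f (f z) = z.
Proof.
intros Hinj Dz; destruct (disk_inverse_spec f (f z)) as [H1 H2]; [ now exists z | ].
now apply Hinj.
Qed.

Lemma image_open (f : C -> C) (v : C) :
  (forall z, disk z -> chol2 f z) -> injective_on disk f -> image f disk v ->
  exists e, 0 < e /\ forall v', Cmod (v' - v) < e -> image f disk v'.
Proof.
intros Hf Hinj [z0 [D0 <-]]; unfold disk in D0.
destruct (injective_open f z0 ((1 - Cmod z0) / 2)) as [e [He H]]; auto; try lra.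
exists e; split; auto; intros v' Hv'; destruct (H v' Hv') as [z [Hz Ez]].
exists z; split; auto; unfold disk; generalize (Cmod_triangle_rev z z0); lra.
Qed.

Lemma disk_inverse_ccont (f : C -> C) (v : C) :
  (forall z, disk z -> chol2 f z) -> injective_on disk f -> image f disk v ->
  ccont (disk_inverse f) v.
Proof.
intros Hf Hinj [z0 [D0 <-]] e He; assert (D0' := D0); unfold disk in D0'.
assert (P : 0 < Rmin e ((1 - Cmod z0) / 2)) by (apply Rmin_glb_lt; lra).
assert (M1 := Rmin_l e ((1 - Cmod z0) / 2)); assert (M2 := Rmin_r e ((1 - Cmod z0) / 2)).
destruct (injective_open f z0 _ Hf Hinj P) as [d [D H]]; [ lra | ].
exists d; split; auto; intros v Hv; destruct (H v Hv) as [z [Hz <-]].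
rewrite !disk_inverse_f; auto; [ lra | ].
unfold disk; generalize (Cmod_triangle_rev z z0); lra.
Qed.

(** Caratheodory's identity [u - v = phi (F u) * (F u - z0)], with [F] the inverse, can be divided
    by [phi (F u)]: this factor is continuous in [u] and nonzero at [v]. *)
Lemma disk_inverse_cder (f f1 : C -> C) (v : C) :
  (forall z, disk z -> chol2 f z) -> (forall z, disk z -> cder f z (f1 z)) ->
  injective_on disk f -> image f disk v ->
  cder (disk_inverse f) v (/ f1 (disk_inverse f v)).
Proof.
intros Hf Hf1 Hinj Hv; assert (HF := disk_inverse_ccont f v Hf Hinj Hv).
destruct (disk_inverse_spec f v Hv) as [D0 E0]; set (z0 := disk_inverse f v) in *.
assert (N := injective_cder_ne_0 f f1 z0 Hf Hf1 Hinj D0).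
destruct (Hf1 z0 D0) as [phi [Pc [P1 Pf]]].
assert (Cphi : ccont (fun v => phi (disk_inverse f v)) v) by now apply (ccont_comp phi).
assert (Nphi : phi (disk_inverse f v) <> 0) by (fold z0; now rewrite P1).
destruct (ccont_ne_0 _ _ Cphi Nphi) as [d [D Hd]].
destruct (image_open f v Hf Hinj Hv) as [e [He Hi]].
apply (cder_ext_loc (fun u => z0 + / phi (disk_inverse f u) * (u - v))%C _ v _ (Rmin d e)).
- now apply Rmin_glb_lt.
- intros u Hu; specialize (Hd u (Rlt_le_trans _ _ _ Hu (Rmin_l _ _))).
  destruct (disk_inverse_spec f u (Hi u (Rlt_le_trans _ _ _ Hu (Rmin_r _ _)))) as [_ Eu].
  rewrite <- Eu at 2; rewrite (Pf (disk_inverse f u)), E0; field; auto.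
- exists (fun u => / phi (disk_inverse f u))%C; split; [ now apply ccont_inv | split].
  + fold z0; now rewrite P1.
  + intros u; ring.
Qed.

Lemma disk_inverse_chol2 (f f1 : C -> C) (v : C) :
  (forall z, disk z -> chol2 f z) -> (forall z, disk z -> cder f z (f1 z)) ->
  (forall z, disk z -> chol f1 z) ->
  injective_on disk f -> image f disk v -> chol2 (disk_inverse f) v.
Proof.
intros Hf Hf1 Hf2 Hinj Hv.
destruct (image_open f v Hf Hinj Hv) as [e [He Hi]].
destruct (disk_inverse_spec f v Hv) as [D0 E0].
exists (fun u => / f1 (disk_inverse f u))%C, e; split; [ auto | split].
- intros u Hu; apply disk_inverse_cder; auto.
- apply (chol_inv (fun u => f1 (disk_inverse f u))).
  + apply (chol_comp f1 (disk_inverse f)); auto.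
    eexists; eapply disk_inverse_cder; eauto.
  + now apply (injective_cder_ne_0 f f1).
Qed.

(** * The generator *)

Lemma Cinv_circle (z : C) (r : R) : Cmod z = r -> 0 < r -> (/ z)%C = (Cconj z * RtoC (/ (r * r)))%C.
Proof.
intros Hz Hr.
assert (N : z <> 0) by (apply Cmod_gt_0; lra).
assert (E : (z * Cconj z)%C = RtoC (r * r)).
{ rewrite <- Cmod2_conj, Hz; f_equal; ring. }
assert (Nr : RtoC (r * r) <> 0) by (intros Ec; apply RtoC_inj in Ec; nra).
rewrite RtoC_inv by nra; rewrite <- E in Nr |- *; field; split; auto.
intros Ec; apply Nr; rewrite Ec; ring.
Qed.

(* On [|z| = r] the term [b - conj b z^2 / r^2] is invisible to [Re (conj z * _)],
   which leaves [Re (conj z * psi z) - r^2 <= r - r^2]. *)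
Lemma self_map_Re_circle (psi : C -> C) (z : C) (r : R) :
  0 < r < 1 -> (forall z, disk z -> chol2 psi z) -> (forall z, disk z -> disk (psi z)) ->
  Cmod z <= r -> z <> 0 ->
  Re ((psi z - z - psi 0) / z + Cconj (psi 0) * z * RtoC (/ (r * r)))%C <= (1 - r) / r.
Proof.
intros Hr Hpsi Hself Hz Hz0; set (b := psi 0).
assert (D0 : disk 0) by (unfold disk; rewrite Cmod_0; lra).
destruct (chol2_cder psi 0 (Hpsi 0 D0)) as [l [phi [Pc [_ Pf]]]].
destruct (ccont_bounded phi 0 Pc) as [eta [Heta Hb]].
assert (Hi : 0 < / (r * r)) by (apply Rinv_0_lt_compat; nra).
apply (max_principle_Re (fun z => (psi z + - z + - b) * / z + Cconj b * z * RtoC (/ (r * r)))%C 0 0 r ((1 - r) / r)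
  (Cmod (phi 0) + 2 + Cmod b * / (r * r)) eta Heta); auto.
- intros u Hu Hu0; replace (u - 0)%C with u in Hu by ring.
  apply chol2_plus; apply chol2_mult; repeat apply chol2_plus; try apply chol2_const; try apply chol2_id.
  + apply Hpsi; unfold disk; lra.
  + apply chol2_ext_loc with (fun v => -(1) * v)%C 1; [ lra | intros; ring | ].
    apply chol2_mult; [ apply chol2_const | apply chol2_id].
  + apply (chol2_inv (fun v => v)); auto; apply chol2_id.
  + apply chol2_mult; [ apply chol2_const | apply chol2_id].
- intros u Hu Hu0 Hn; eapply Rle_trans; [ apply Re_le_Cmod | ].
  replace ((psi u + - u + - b) * / u)%C with (phi u + - (1))%C.
  2:{ rewrite (Pf u); fold b; field; auto. }
  replace (u - 0)%C with u in Hu by ring.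
  specialize (Hb u Hn).
  eapply Rle_trans; [ apply Cmod_triangle | ].
  assert (A1 := Cmod_triangle (phi u) (- (1))); rewrite Cmod_opp, Cmod_1 in A1.
  rewrite !Cmod_mult, Cmod_conj, Cmod_R, (Rabs_pos_eq (/ _)) by lra.
  assert (A2 : Cmod b * Cmod u * / (r * r) <= Cmod b * / (r * r)).
  { apply Rmult_le_compat_r; [ lra | ]; rewrite <- (Rmult_1_r (Cmod b)) at 2.
    apply Rmult_le_compat_l; [ apply Cmod_ge_0 | lra]. }
  lra.
- intros u Hu Hu0; replace (u - 0)%C with u in Hu by ring.
  rewrite (Cinv_circle u r Hu) by lra.
  assert (Hpu : Cmod (psi u) < 1) by (apply Hself; unfold disk; lra).
  replace ((psi u + - u + - b) * (Cconj u * RtoC (/ (r * r))) + Cconj b * u * RtoC (/ (r * r)))%C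
    with (RtoC (/ (r * r)) * (psi u * Cconj u + - (u * Cconj u) + (- (b * Cconj u) + Cconj b * u)))%C by ring.
  rewrite re_scal_l, !re_plus, re_opp, <- Cmod2_conj, Hu, re_RtoC.
  replace (Re (- (b * Cconj u)) + Re (Cconj b * u)) with 0 by (destruct b, u; simpl; ring).
  assert (A : Re (psi u * Cconj u) <= r).
  { eapply Rle_trans; [ apply Re_le_Cmod | ]; rewrite Cmod_mult, Cmod_conj, Hu.
    assert (Cmod (psi u) * r <= 1 * r) by (apply Rmult_le_compat_r; lra); lra. }
  replace ((1 - r) / r) with (/ (r * r) * (r - r * r)) by (field; lra).
  apply Rmult_le_compat_l; [ lra | replace (r ^ 2) with (r * r) by ring; lra].
- replace (z - 0)%C with z by ring; auto.
Qed.

(** The limit [r -> 1] of the bound on circles. The left side vanishes when [psi] is the identity,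
    so the inequality can be differentiated along a family of self-maps that starts there. *)
Lemma self_map_Re (psi : C -> C) (z : C) :
  (forall z, disk z -> chol2 psi z) -> (forall z, disk z -> disk (psi z)) ->
  disk z -> z <> 0 -> Re ((psi z - z - psi 0) / z + Cconj (psi 0) * z)%C <= 0.
Proof.
intros Hpsi Hself Dz Hz0; unfold disk in Dz.
rewrite re_plus; set (A := Re ((psi z - z - psi 0) / z)); set (B := Re (Cconj (psi 0) * z)).
apply Rnot_lt_le; intros Hg.
assert (PA := Rabs_pos A); assert (PA' := Rle_abs A).
assert (Pz := proj1 (Cmod_gt_0 z) Hz0).
(* With [r = 1 - x] the bound on circles gives [A + B <= x * (2 * Rabs A + 1)]; this [x] makes the
   right side at most half of [A + B]. *)
set (x := Rmin ((1 - Cmod z) / 2) ((A + B) / (2 * (2 * Rabs A + 1)))).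
assert (X0 : 0 < x) by (apply Rmin_glb_lt; [ lra | apply Rdiv_lt_0_compat; lra]).
assert (X1 : x <= (1 - Cmod z) / 2) by apply Rmin_l.
assert (X2 : x <= (A + B) / (2 * (2 * Rabs A + 1))) by apply Rmin_r.
assert (X3 : x * (2 * Rabs A + 1) <= (A + B) / 2).
{ apply Rle_trans with ((A + B) / (2 * (2 * Rabs A + 1)) * (2 * Rabs A + 1)).
  - apply Rmult_le_compat_r; lra.
  - right; field; lra. }
set (r := 1 - x).
assert (H := self_map_Re_circle psi z r ltac:(unfold r; lra) Hpsi Hself ltac:(unfold r; lra) Hz0).
rewrite re_plus, re_scal_r in H; fold A B in H.
assert (H' : A * (r * r) + B <= (1 - r) * r).
{ apply Rmult_le_compat_l with (r := r * r) in H; [ | unfold r; nra].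
  replace (r * r * (A + B * / (r * r))) with (A * (r * r) + B) in H by (field; unfold r; lra).
  replace (r * r * ((1 - r) / r)) with ((1 - r) * r) in H by (field; unfold r; lra); exact H. }
replace (A * (r * r) + B) with (A + B - A * (x * (2 - x))) in H' by (unfold r; ring).
replace ((1 - r) * r) with (x - x * x) in H' by (unfold r; ring).
assert (x < 1) by lra.
assert (A * (x * (2 - x)) <= Rabs A * (2 * x)).
{ apply Rle_trans with (Rabs A * (x * (2 - x))).
  - apply Rmult_le_compat_r; auto; apply Rmult_le_pos; lra.
  - apply Rmult_le_compat_l; auto; nra. }
nra.
Qed.

Lemma is_derive_0_ge_0 (h : R -> R) (l : R) :
  is_derive h 0 l -> h 0 = 0 -> (forall t, 0 < t < 1 -> 0 <= h t) -> 0 <= l.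
Proof.
intros H H0 Ht; apply is_derive_Reals in H; apply Rnot_lt_le; intros Hl.
destruct (H (- l) ltac:(lra)) as [[d D] K]; simpl in K.
set (t := Rmin d 1 / 2).
assert (T : 0 < Rmin d 1) by (apply Rmin_glb_lt; lra).
assert (T1 := Rmin_l d 1); assert (T2 := Rmin_r d 1).
specialize (K t ltac:(unfold t; lra) ltac:(rewrite Rabs_pos_eq; unfold t; lra)).
rewrite Rplus_0_l, H0, Rminus_0_r in K; apply Rabs_def2 in K.
specialize (Ht t ltac:(unfold t; lra)).
assert (0 <= h t / t) by (apply Rdiv_le_0_compat; unfold t in *; lra); lra.
Qed.

(* [G z = (w - f z) / f' z] is the generator of the semigroup of self-maps
   [f^-1 ((1 - s) f + s w)]. *)
Lemma generator_Re (f f1 : C -> C) (w z : C) :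
  (forall z, disk z -> chol2 f z) -> (forall z, disk z -> cder f z (f1 z)) ->
  (forall z, disk z -> chol f1 z) ->
  injective_on disk f -> f 0 = 0 -> f1 0 = 1 ->
  (forall v s, image f disk v -> 0 <= s < 1 -> image f disk (v + RtoC s * (w - v))%C) ->
  disk z -> z <> 0 ->
  0 <= Re ((w - Cconj w * (z * z) - (w - f z) / f1 z) / z)%C.
Proof.
intros Hf Hf1 Hf2 Hinj f00 f10 Hstar Dz Hz0.
set (F := disk_inverse f).
assert (D0 : disk 0) by (unfold disk; rewrite Cmod_0; lra).
assert (Himg : forall z, disk z -> image f disk (f z)) by (intros u Du; exists u; auto).
assert (F0 : F 0 = 0) by (rewrite <- f00 at 1; apply disk_inverse_f; auto).
assert (Fz : F (f z) = z) by (apply disk_inverse_f; auto).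
(* For real [s] this has the real part of minus the expression in [self_map_Re] for [psi_s], where
   [psi_s 0 = F (s * w)]. The conjugate is moved from [psi_s 0] to the fixed [z], which keeps [Re]
   and makes [P] complex differentiable in [s]. *)
set (P s := (F (s * w) * (/ z + - Cconj z) + (- (1) * / z) * (F (f z + s * (w - f z)) + - z))%C).
assert (HP : is_derive (fun t : R => Re (P (0 + RtoC t * 1)%C)) 0
  (Re ((w - Cconj w * (z * z) - (w - f z) / f1 z) / z)%C)).
{ assert (N1 := injective_cder_ne_0 f f1 z Hf Hf1 Hinj Dz).
  replace (Re ((w - Cconj w * (z * z) - (w - f z) / f1 z) / z)%C)
    with (Re ((1 * w * (/ z + - Cconj z) + (- (1) * / z) * (/ f1 z * (w - f z))) * 1)%C).
  2:{ replace ((w - Cconj w * (z * z) - (w - f z) / f1 z) / z)%C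
        with (w * / z + - (Cconj w * z) + (- (1) * / z) * (/ f1 z * (w - f z)))%C by (field; auto).
      replace ((1 * w * (/ z + - Cconj z) + (- (1) * / z) * (/ f1 z * (w - f z))) * 1)%C
        with (w * / z + - (w * Cconj z) + (- (1) * / z) * (/ f1 z * (w - f z)))%C by ring.
      rewrite !re_plus, !re_opp.
      replace (Re (Cconj w * z)) with (Re (w * Cconj z)) by (destruct w, z; simpl; ring); reflexivity. }
  apply cder_line; replace (0 + RtoC 0 * 1)%C with (RtoC 0) by ring.
  unfold P; apply cder_plus.
  - apply cder_value with (1 * w * (/ z + - Cconj z) + F (0 * w) * 0)%C; [ ring | ].
    apply (cder_mult (fun s => F (s * w))%C (fun _ => / z + - Cconj z)%C); [ | apply cder_const].
    apply (cder_comp F (fun s => s * w)%C).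
    + apply cder_value with (/ f1 (disk_inverse f (0 * w)))%C.
      { replace (0 * w)%C with (RtoC 0) by ring; fold F; rewrite F0, f10; field. }
      replace (0 * w)%C with (f 0) by (rewrite f00; ring); apply disk_inverse_cder; auto.
    + apply cder_value with (1 * w + 0 * 0)%C; [ ring | apply cder_mult; [ apply cder_id | apply cder_const]].
  - apply cder_value with (0 * (F (f z + 0 * (w - f z)) + - z) + (- (1) * / z) * (/ f1 z * (w - f z) + 0))%C; [ ring | ].
    apply (cder_mult (fun _ => - (1) * / z)%C (fun s => F (f z + s * (w - f z)) + - z)%C); [ apply cder_const | ].
    apply (cder_plus (fun s => F (f z + s * (w - f z)))%C (fun _ => - z)%C); [ | apply cder_const].
    apply (cder_comp F (fun s => f z + s * (w - f z))%C).
    + replace (f z + 0 * (w - f z))%C with (f z) by ring.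
      rewrite <- Fz at 2; apply disk_inverse_cder; auto.
    + apply cder_value with (0 + (1 * (w - f z) + 0 * 0))%C; [ ring | ].
      apply cder_plus; [ apply cder_const | ].
      apply (cder_mult (fun s => s) (fun _ => w - f z)%C); [ apply cder_id | apply cder_const]. }
apply (is_derive_0_ge_0 _ _ HP).
- replace (0 + RtoC 0 * 1)%C with (RtoC 0) by ring; unfold P.
  replace (0 * w)%C with (RtoC 0) by ring.
  replace (f z + 0 * (w - f z))%C with (f z) by ring; rewrite F0, Fz.
  replace (0 * (/ z + - Cconj z) + - (1) * / z * (z + - z))%C with (RtoC 0) by ring; reflexivity.
- intros s Hs; replace (0 + RtoC s * 1)%C with (RtoC s) by ring.
  set (psi u := F (f u + RtoC s * (w - f u))%C).
  assert (Hin : forall u, disk u -> image f disk (f u + RtoC s * (w - f u))%C).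
  { intros u Du; apply Hstar; auto; lra. }
  assert (H := self_map_Re psi z).
  replace (P (RtoC s)) with (- ((psi z - z - psi 0) / z + psi 0 * Cconj z))%C.
  2:{ unfold P, psi; rewrite f00; replace (0 + RtoC s * (w - 0))%C with (RtoC s * w)%C by ring; field; auto. }
  rewrite re_opp, re_plus; rewrite re_plus in H.
  replace (Re (psi 0 * Cconj z)) with (Re (Cconj (psi 0) * z)) by (destruct (psi 0), z; simpl; ring).
  assert (Re ((psi z - z - psi 0) / z) + Re (Cconj (psi 0) * z) <= 0); [ | lra].
  apply H; auto.
  + intros u Du; apply (chol2_comp F (fun u => f u + RtoC s * (w - f u))%C).
    * apply (disk_inverse_chol2 f f1); auto.
    * apply chol2_ext_loc with (fun u => RtoC (1 - s) * f u + RtoC s * w)%C 1; [ lra | | ].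
      { intros v _; rewrite RtoC_minus; ring. }
      apply chol2_plus; [ apply chol2_mult; [ apply chol2_const | auto] | apply chol2_const].
  + intros u Du; apply disk_inverse_spec; auto.
Qed.

(** * Rigidity when the real part attains its minimum *)

Lemma chol2_quadratic (g : C -> C) (z0 l : C) :
  chol2 g z0 -> cder g z0 l ->
  exists K d, 0 <= K /\ 0 < d /\ forall z, Cmod (z - z0) < d ->
    Cmod (g z - g z0 - l * (z - z0)) <= K * (Cmod (z - z0) * Cmod (z - z0)).
Proof.
intros [g1 [r [Hr [Hg [l2 Hl2]]]]] Hl.
assert (E1 : g1 z0 = l).
{ apply (cder_unique g z0); auto; apply Hg; rewrite Cmod_sub_self; auto. }
destruct (proj1 (cder_eps _ _ _) Hl2 1 Rlt_0_1) as [d [D H]].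
assert (P2 := Cmod_ge_0 l2).
exists (2 * (Cmod l2 + 1)), (Rmin r d); split; [ lra | split; [ now apply Rmin_glb_lt | ]].
intros z Hz.
assert (Z1 := Rlt_le_trans _ _ _ Hz (Rmin_l _ _)); assert (Z2 := Rlt_le_trans _ _ _ Hz (Rmin_r _ _)).
assert (Hseg : forall t, 0 <= t <= 1 -> Cmod (z0 + RtoC t * (z - z0) - z0) <= Cmod (z - z0)).
{ intros t Ht; replace (z0 + RtoC t * (z - z0) - z0)%C with (RtoC t * (z - z0))%C by ring.
  rewrite Cmod_mult, Cmod_R, Rabs_pos_eq by lra; generalize (Cmod_ge_0 (z - z0)); nra. }
replace (g z - g z0 - l * (z - z0))%C with ((g z + - l * z) - (g z0 + - l * z0))%C by ring.
eapply Rle_trans.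
{ apply (cder_segment_bound (fun u => g u + - l * u)%C (fun u => g1 u + - l)%C z0 z ((Cmod l2 + 1) * Cmod (z - z0))).
  - intros t Ht; specialize (Hseg t Ht).
    apply cder_plus; [ apply Hg; lra | ].
    set (x := (z0 + RtoC t * (z - z0))%C).
    apply cder_value with (0 * x + - l * 1)%C; [ ring | ].
    apply (cder_mult (fun _ => - l)%C (fun u => u)); [ apply cder_const | apply cder_id].
  - intros t Ht; specialize (Hseg t Ht); set (u := (z0 + RtoC t * (z - z0))%C) in *.
    specialize (H u ltac:(lra)); rewrite E1 in H.
    replace (g1 u + - l)%C with ((g1 u - l - l2 * (u - z0)) + l2 * (u - z0))%C by ring.
    eapply Rle_trans; [ apply Cmod_triangle | ]; rewrite Cmod_mult; nra. }
right; ring.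
Qed.

(** For [e > 0] the Cayley transform [X / (X + 2e)] of [X = q - k] maps into the unit disk and tends
    to 0 at the origin, so Schwarz's lemma bounds it by [|z|]. Letting [e] tend to 0 gives
    [|X| <= |z| |X|], hence [X = 0]. The Lipschitz hypothesis stands in for a value of [q] at 0. *)
Lemma Re_ge_0_rigidity (q : C -> C) (k : C) (K d : R) :
  (forall z, disk z -> z <> 0 -> chol2 q z) ->
  0 <= K -> 0 < d -> (forall z : C, z <> 0 -> Cmod z < d -> Cmod (q z - k) <= K * Cmod z) ->
  (forall z, disk z -> z <> 0 -> 0 <= Re (q z)) -> Re k = 0 ->
  forall z, disk z -> z <> 0 -> q z = k.
Proof.
intros Hq HK Hd Hlip Hre Hk z Dz Hz0; unfold disk in Dz.
assert (Hden : forall e u, 0 < e -> disk u -> u <> 0 ->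
  2 * e <= Cmod (q u + - k + RtoC (2 * e)) /\ Cmod (q u + - k) <= Cmod (q u + - k + RtoC (2 * e))).
{ intros e u He Du Hu0; assert (H := Hre u Du Hu0).
  assert (HX : 0 <= Re (q u + - k)) by (rewrite re_plus, re_opp; lra).
  set (X := (q u + - k)%C) in *.
  split.
  - generalize (Re_le_Cmod (X + RtoC (2 * e))); rewrite re_plus, re_RtoC; lra.
  - assert (H1 := Cmod2_alt X); assert (H2 := Cmod2_alt (X + RtoC (2 * e))).
    rewrite re_plus, re_RtoC in H2.
    replace (Im (X + RtoC (2 * e))) with (Im X) in H2 by (unfold Im; simpl; ring).
    generalize (Cmod_ge_0 X) (Cmod_ge_0 (X + RtoC (2 * e))); intros P1 P2.
    apply Rnot_lt_le; intros L; nra. }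
assert (Hne : forall e u, 0 < e -> disk u -> u <> 0 -> (q u + - k + RtoC (2 * e))%C <> 0).
{ intros e u He Du Hu0; apply Cmod_gt_0; generalize (proj1 (Hden e u He Du Hu0)); lra. }
assert (Pz := proj1 (Cmod_gt_0 z) Hz0).
assert (Hschwarz : forall e r, 0 < e -> Cmod z <= r < 1 ->
  Cmod ((q z + - k) * / (q z + - k + RtoC (2 * e)) * / z) <= / r).
{ intros e r He Hr.
  apply (max_modulus (fun u => (q u + - k) * / (q u + - k + RtoC (2 * e)) * / u)%C 0 0 r (/ r) (K / (2 * e)) d); auto.
  - left; apply Rinv_0_lt_compat; lra.
  - intros u Hu Hu0; replace (u - 0)%C with u in Hu by ring.
    assert (Du : disk u) by (unfold disk; lra).
    assert (Cq : chol2 (fun u => q u + - k)%C u) by (apply chol2_plus; [ auto | apply chol2_const]).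
    apply chol2_mult; [ apply chol2_mult; auto | apply (chol2_inv (fun u => u)); auto; apply chol2_id].
    apply (chol2_inv (fun u => q u + - k + RtoC (2 * e))%C); auto.
    apply chol2_plus; [ auto | apply chol2_const].
  - intros u Hu Hu0 Hn; replace (u - 0)%C with u in Hu, Hn by ring.
    assert (Du : disk u) by (unfold disk; lra).
    destruct (Hden e u He Du Hu0) as [H1 _]; specialize (Hlip u Hu0 Hn).
    assert (Pu := proj1 (Cmod_gt_0 u) Hu0).
    rewrite !Cmod_mult, !Cmod_inv by auto.
    apply Rmult_le_reg_r with (Cmod u); auto.
    rewrite Rmult_assoc, Rinv_l, Rmult_1_r by lra.
    replace (K / (2 * e) * Cmod u) with (K * Cmod u * / (2 * e)) by (field; lra).
    apply Rmult_le_compat; auto; try apply Cmod_ge_0.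
    + left; apply Rinv_0_lt_compat; lra.
    + apply Rinv_le_contravar; lra.
  - intros u Hu Hu0; replace (u - 0)%C with u in Hu by ring.
    assert (Du : disk u) by (unfold disk; lra).
    destruct (Hden e u He Du Hu0) as [H1 H2].
    rewrite !Cmod_mult, !Cmod_inv, Hu by auto.
    assert (Cmod (q u + - k) * / Cmod (q u + - k + RtoC (2 * e)) <= 1).
    { apply Rmult_le_reg_r with (Cmod (q u + - k + RtoC (2 * e))); [ lra | ].
      rewrite Rmult_assoc, Rinv_l; lra. }
    assert (0 < / r) by (apply Rinv_0_lt_compat; lra).
    nra.
  - replace (z - 0)%C with z by ring; lra. }
assert (Hle : forall e r, 0 < e -> Cmod z <= r < 1 ->
  r * Cmod (q z + - k) <= Cmod z * (Cmod (q z + - k) + 2 * e)).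
{ intros e r He Hr; assert (H := Hschwarz e r He Hr).
  assert (N := Hne e z He Dz Hz0); assert (P := proj1 (Cmod_gt_0 _) N).
  assert (T := Cmod_triangle (q z + - k) (RtoC (2 * e))); rewrite Cmod_R, (Rabs_pos_eq (2 * e)) in T by lra.
  rewrite !Cmod_mult, !Cmod_inv in H by auto.
  apply Rle_trans with (Cmod z * Cmod (q z + - k + RtoC (2 * e))); [ | apply Rmult_le_compat_l; lra].
  apply Rmult_le_compat_l with (r := r * (Cmod z * Cmod (q z + - k + RtoC (2 * e)))) in H.
  - replace (r * (Cmod z * Cmod (q z + - k + RtoC (2 * e))) * / r) with (Cmod z * Cmod (q z + - k + RtoC (2 * e))) in H by (field; lra).
    replace (r * (Cmod z * Cmod (q z + - k + RtoC (2 * e))) * (Cmod (q z + - k) * / Cmod (q z + - k + RtoC (2 * e)) * / Cmod z))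
      with (r * Cmod (q z + - k)) in H by (field; lra); exact H.
  - apply Rmult_le_pos; [ lra | apply Rmult_le_pos; lra]. }
replace (q z) with ((q z + - k) + k)%C by ring.
rewrite (Cmod_lt_eps_0 (q z + - k)); [ ring | ]; intros e He.
set (r := (Cmod z + 1) / 2).
(* This parameter turns [(r - |z|) |q - k| <= 2 |z| e'] into [|q - k| <= e]. *)
assert (He' : 0 < e * (r - Cmod z) / 2) by (apply Rdiv_lt_0_compat; [ apply Rmult_lt_0_compat; unfold r; lra | lra]).
assert (H := Hle (e * (r - Cmod z) / 2) r He' ltac:(unfold r; lra)).
apply Rmult_le_reg_r with (r - Cmod z); [ unfold r; lra | ].
assert (Cmod z * (2 * (e * (r - Cmod z) / 2)) <= 1 * (2 * (e * (r - Cmod z) / 2))) by (apply Rmult_le_compat_r; lra).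
lra.
Qed.

(** [q = k] off the origin says that [G] is this quadratic polynomial; the form multiplied by [f1]
    also covers the origin. *)
Lemma generator_quadratic (f f1 f2 : C -> C) (w : C) :
  (forall z, disk z -> chol2 f z) -> (forall z, disk z -> cder f z (f1 z)) ->
  (forall z, disk z -> chol2 f1 z) -> (forall z, disk z -> cder f1 z (f2 z)) ->
  injective_on disk f -> f 0 = 0 -> f1 0 = 1 ->
  (forall v s, image f disk v -> 0 <= s < 1 -> image f disk (v + RtoC s * (w - v))%C) ->
  Re (1 + w * f2 0)%C = 0 ->
  forall z, disk z -> (w - f z)%C = (f1 z * (w - (1 + w * f2 0) * z - Cconj w * (z * z)))%C.
Proof.
intros Hf Hf1 Cf1 Hf2 Hinj f00 f10 Hstar Hk z Dz.
assert (Hf2' : forall z, disk z -> chol f1 z) by (intros; apply chol2_cder; auto).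
assert (D0 : disk 0) by (unfold disk; rewrite Cmod_0; lra).
assert (Hne : forall z, disk z -> f1 z <> 0) by (intros; apply (injective_cder_ne_0 f f1); auto).
set (k := (1 + w * f2 0)%C) in *.
set (G u := ((w + - (1) * f u) * / f1 u)%C).
assert (CG : forall u, disk u -> chol2 G u).
{ intros u Du; apply chol2_mult; [ apply chol2_plus; [ apply chol2_const | ] | apply chol2_inv; auto].
  apply chol2_mult; [ apply chol2_const | auto]. }
assert (G0 : G 0 = w) by (unfold G; rewrite f00, f10; field; intros E; apply RtoC_inj in E; lra).
assert (DG : cder G 0 (- k)).
{ apply cder_value with ((0 + (0 * f 0 + - (1) * f1 0)) * / f1 0 + (w + - (1) * f 0) * (- f2 0 * / (f1 0 * f1 0)))%C.
  { rewrite f00, f10; unfold k; field; intros E; apply RtoC_inj in E; lra. }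
  apply (cder_mult (fun u => w + - (1) * f u)%C (fun u => / f1 u)%C); [ | apply cder_inv; auto].
  apply (cder_plus (fun _ => w) (fun u => - (1) * f u)%C); [ apply cder_const | ].
  apply (cder_mult (fun _ => - (1))%C f); [ apply cder_const | auto]. }
destruct (chol2_quadratic G 0 (- k) (CG 0 D0) DG) as [K [d [HK [Hd HQ]]]].
set (q u := ((w + - Cconj w * (u * u) + - (1) * G u) * / u)%C).
destruct (classic (z = 0)) as [-> | Hz0].
{ rewrite f00, f10; ring. }
(* In the Lipschitz constant, [K] comes from the second-order error of [G] at 0 after division by
   [u], and [Cmod w] from the term [Cconj w * u]. *)
assert (Hq : q z = k).
{ apply (Re_ge_0_rigidity q k (K + Cmod w) d); auto.
  - intros u Du Hu0; apply chol2_mult; [ | apply (chol2_inv (fun u => u)); auto; apply chol2_id].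
    repeat apply chol2_plus; try apply chol2_const; apply chol2_mult; try apply chol2_const; auto.
    apply chol2_mult; apply chol2_id.
  - generalize (Cmod_ge_0 w); lra.
  - intros u Hu0 Hu; assert (Pu := proj1 (Cmod_gt_0 u) Hu0).
    replace (u - 0)%C with u in HQ by ring.
    specialize (HQ u); rewrite G0 in HQ.
    replace (u - 0)%C with u in HQ by ring.
    specialize (HQ Hu).
    replace (q u - k)%C with (- (G u - w - - k * u) * / u + - (Cconj w * u))%C by (unfold q; field; auto).
    eapply Rle_trans; [ apply Cmod_triangle | ].
    rewrite Cmod_opp, !Cmod_mult, Cmod_opp, Cmod_conj, Cmod_inv by auto.
    assert (Cmod (G u - w - - k * u) * / Cmod u <= K * Cmod u).
    { apply Rmult_le_reg_r with (Cmod u); auto; rewrite Rmult_assoc, Rinv_l; lra. }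
    lra.
  - intros u Du Hu0; assert (H := generator_Re f f1 w u Hf Hf1 Hf2' Hinj f00 f10 Hstar Du Hu0).
    replace (q u) with ((w - Cconj w * (u * u) - (w - f u) / f1 u) / u)%C; [ exact H | ].
    unfold q, G; field; auto. }
unfold q in Hq.
assert (HG : G z = (w - k * z - Cconj w * (z * z))%C) by (rewrite <- Hq; field; auto).
rewrite <- HG; unfold G; field; auto.
Qed.

(** * Invariance of the image under dilations *)

Lemma boundary_value_lim (f : C -> C) (zeta w : C) :
  boundary_value f zeta (Fin w) ->
  forall e, 0 < e -> exists d, 0 < d /\
    forall z, disk z -> Cmod (z - zeta) < d -> Cmod (f z - w) < e.
Proof.
intros H e He.
set (A := sqrt (1 + Cmod w ^ 2)); set (B := 1 + Cmod w).
assert (Pw := Cmod_ge_0 w).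
assert (HA : 0 < A) by (apply sqrt_lt_R0; nra).
assert (HB : 0 < B) by (unfold B; lra).
(* The chordal denominator may grow with [X], the distance to [w]. The bound [/ A] absorbs that
   growth into the left side of [2 X < e + X]; the other bound yields [e]. *)
set (eta := Rmin (/ A) (e / (A * B))).
assert (Heta : 0 < eta).
{ apply Rmin_glb_lt; [ now apply Rinv_0_lt_compat | apply Rdiv_lt_0_compat; auto; now apply Rmult_lt_0_compat]. }
assert (E1 : eta * A <= 1).
{ apply Rle_trans with (/ A * A); [ apply Rmult_le_compat_r; [ lra | apply Rmin_l] | right; field; lra]. }
assert (E2 : eta * A * B <= e).
{ apply Rle_trans with (e / (A * B) * (A * B)); [ rewrite Rmult_assoc; apply Rmult_le_compat_r; [ nra | apply Rmin_r] | right; field; lra]. }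
assert (L : locally 0 (fun y : R => Rabs y < eta)).
{ exists (mkposreal _ Heta); intros y Hy; change (Rabs (y - 0) < eta) in Hy; now rewrite Rminus_0_r in Hy. }
specialize (H _ L); unfold filtermap, within in H; apply locally_Cmod in H.
destruct H as [d [D H]]; exists d; split; auto; intros z Dz Hz; specialize (H z Hz Dz).
unfold chordal in H; fold A in H; set (X := Cmod (f z - w)) in *.
assert (PX : 0 <= X) by apply Cmod_ge_0.
set (Q := sqrt (1 + Cmod (f z) ^ 2)) in *.
assert (Pf := Cmod_ge_0 (f z)).
assert (HQ : 0 < Q) by (apply sqrt_lt_R0; nra).
assert (HQ' : Q <= B + X).
{ apply Rle_trans with (1 + Cmod (f z)).
  - unfold Q; rewrite <- (sqrt_square (1 + Cmod (f z))) by lra; apply sqrt_le_1_alt; nra.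
  - unfold B, X; generalize (Cmod_triangle_rev (f z) w); lra. }
assert (HQA : 0 < Q * A) by now apply Rmult_lt_0_compat.
apply Rabs_def2 in H; destruct H as [H _].
apply Rmult_lt_compat_r with (r := Q * A) in H; auto.
replace (2 * X / (Q * A) * (Q * A)) with (2 * X) in H by (field; lra).
assert (eta * (Q * A) <= eta * A * (B + X)).
{ replace (eta * (Q * A)) with (eta * A * Q) by ring; apply Rmult_le_compat_l; auto; nra. }
assert (eta * A * X <= 1 * X) by (apply Rmult_le_compat_r; auto).
nra.
Qed.

Lemma disk_near_circle (zeta : C) (d : R) :
  Cmod zeta = 1 -> 0 < d -> exists z, disk z /\ Cmod (z - zeta) < d.
Proof.
intros Hz Hd; set (x := Rmin (d / 2) (/ 2)).
assert (X0 : 0 < x) by (apply Rmin_glb_lt; lra).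
assert (X1 : x <= d / 2) by apply Rmin_l; assert (X2 : x <= / 2) by apply Rmin_r.
exists (RtoC (1 - x) * zeta)%C; split.
- unfold disk; rewrite Cmod_mult, Cmod_R, Hz, Rabs_pos_eq; lra.
- replace (RtoC (1 - x) * zeta - zeta)%C with (- (RtoC x * zeta))%C by (rewrite RtoC_minus; ring).
  rewrite Cmod_opp, Cmod_mult, Cmod_R, Hz, Rabs_pos_eq; lra.
Qed.

(** If [w = f z0], openness produces every value near [w] close to [z0], while such values also
    occur close to [zeta]; this contradicts injectivity. *)
Lemma boundary_value_not_image (f : C -> C) (zeta w : C) :
  (forall z, disk z -> chol2 f z) -> injective_on disk f ->
  Cmod zeta = 1 -> boundary_value f zeta (Fin w) -> ~ image f disk w.
Proof.
intros Hf Hinj Hz Hb [z0 [D0 E0]]; unfold disk in D0.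
set (rho := (1 - Cmod z0) / 2).
destruct (injective_open f z0 rho Hf Hinj) as [e [He H]]; [ unfold rho; lra | unfold rho; lra | ].
destruct (boundary_value_lim f zeta w Hb e He) as [d [D Hd]].
destruct (disk_near_circle zeta (Rmin d rho) Hz) as [z [Dz Hzz]].
{ apply Rmin_glb_lt; unfold rho; lra. }
assert (Z1 := Rlt_le_trans _ _ _ Hzz (Rmin_l _ _)); assert (Z2 := Rlt_le_trans _ _ _ Hzz (Rmin_r _ _)).
rewrite <- E0 in Hd; destruct (H (f z) (Hd z Dz Z1)) as [z' [Hz' Ez']].
apply Hinj in Ez'; auto.
- subst z'; generalize (Cmod_triangle_rev zeta z) (Cmod_triangle_rev z z0).
  rewrite (Cmod_sub_sym zeta z), Hz; unfold rho in *; lra.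
- unfold disk; generalize (Cmod_triangle_rev z' z0); unfold rho in *; lra.
Qed.

(** Only points [f z] near [w] belong to the image, so [w] is replaced by [f z] and [v] is shifted
    to [v'] to keep the same convex combination; openness at [v] allows the shift. *)
Lemma image_star (f : C -> C) (zeta w : C) :
  (forall z, disk z -> chol2 f z) -> injective_on disk f -> convex_set (image f disk) ->
  Cmod zeta = 1 -> boundary_value f zeta (Fin w) ->
  forall v s, image f disk v -> 0 <= s < 1 -> image f disk (v + RtoC s * (w - v))%C.
Proof.
intros Hf Hinj Hconv Hz Hb v s Hv Hs.
destruct (image_open f v Hf Hinj Hv) as [e [He Hi]].
(* The shift is [s / (1 - s)] times the error at [w], so this tolerance keeps it below [e]. *)
destruct (boundary_value_lim f zeta w Hb (e * (1 - s))) as [d [D Hd]]; [ nra | ].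
destruct (disk_near_circle zeta d Hz D) as [z [Dz Hzz]].
specialize (Hd z Dz Hzz).
set (k := RtoC (s / (1 - s))); set (v' := (v + k * (w - f z))%C).
assert (Nc : RtoC (1 - s) <> 0) by (intros E; apply RtoC_inj in E; lra).
assert (Hv' : image f disk v').
{ apply Hi; unfold v'; replace (v + k * (w - f z) - v)%C with (k * (w - f z))%C by ring.
  unfold k; rewrite Cmod_mult, Cmod_R, Cmod_sub_sym, Rabs_pos_eq by (apply Rdiv_le_0_compat; lra).
  apply Rle_lt_trans with (/ (1 - s) * Cmod (f z - w)).
  - apply Rmult_le_compat_r; [ apply Cmod_ge_0 | ].
    unfold Rdiv; rewrite <- (Rmult_1_l (/ (1 - s))) at 2; apply Rmult_le_compat_r; [ | lra].
    left; apply Rinv_0_lt_compat; lra.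
  - apply Rmult_lt_reg_l with (1 - s); [ lra | ].
    rewrite <- Rmult_assoc, Rinv_r by lra; lra. }
replace (v + RtoC s * (w - v))%C with (RtoC (1 - s) * v' + RtoC s * f z)%C.
- apply Hconv; auto; [ now exists z | lra].
- unfold v', k; rewrite RtoC_div by lra; replace (RtoC s) with (1 - RtoC (1 - s))%C by (rewrite RtoC_minus; ring).
  field; auto.
Qed.

(* Along a ray from [w] the preimage [z t] solves [z' = - G z / t], and for the
   quadratic generator [(|z|^2)' = - (2 / t) (1 - |z|^2) Re (conj z w)]: it cannot
   reach the unit circle in finite time. *)
Lemma image_ray (f f1 : C -> C) (w k : C) :
  (forall z, disk z -> chol2 f z) -> (forall z, disk z -> cder f z (f1 z)) ->
  injective_on disk f ->
  (forall v s, image f disk v -> 0 <= s < 1 -> image f disk (v + RtoC s * (w - v))%C) ->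
  (forall z, disk z -> (w - f z)%C = (f1 z * (w - k * z - Cconj w * (z * z)))%C) ->
  Re k = 0 ->
  forall v t, image f disk v -> 1 <= t -> image f disk (w + RtoC t * (v - w))%C.
Proof.
intros Hf Hf1 Hinj Hstar HG Hk v t1 Hv Ht1; apply NNPP; intros N1.
set (I t := image f disk (w + RtoC t * (v - w))%C).
assert (Hdown : forall t t', 0 < t' <= t -> I t -> I t').
{ intros t t' Ht It; unfold I.
  replace (w + RtoC t' * (v - w))%C with
    ((w + RtoC t * (v - w)) + RtoC (1 - t' / t) * (w - (w + RtoC t * (v - w))))%C.
  - apply Hstar; auto.
    assert (0 < t' / t) by (apply Rdiv_lt_0_compat; lra).
    assert (t' / t <= 1); [ | lra].
    apply Rmult_le_reg_r with t; [ lra | ]; unfold Rdiv; rewrite Rmult_assoc, Rinv_l; lra.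
  - rewrite RtoC_minus, RtoC_div by lra; field; intros E; apply RtoC_inj in E; lra. }
assert (I1 : I 1) by (unfold I; replace (w + RtoC 1 * (v - w))%C with v by ring; auto).
destruct (completeness (fun t => 1 <= t /\ I t)) as [R0 [HR1 HR2]].
{ exists t1; intros t [Ht It]; apply Rnot_lt_le; intros L; apply N1, (Hdown t); auto; lra. }
{ exists 1; split; auto; lra. }
assert (HR0 : 1 <= R0) by (apply HR1; split; auto; lra).
assert (HI : forall t, 1 <= t < R0 -> I t).
{ intros t Ht; apply NNPP; intros N.
  assert (R0 <= t); [ | lra]; apply HR2; intros t' [Ht' It'].
  apply Rnot_lt_le; intros L; apply N, (Hdown t'); auto; lra. }
(* The supremum itself is excluded by openness; the rest of the proof shows that the preimages
   nevertheless stay in a compact part of the disk up to [R0]. *)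
assert (NR : ~ I R0).
{ intros IR; destruct (image_open f _ Hf Hinj IR) as [e [He Hi]].
  assert (P := Cmod_ge_0 (v - w)).
  set (x := e / (2 * (Cmod (v - w) + 1))).
  assert (X : 0 < x) by (apply Rdiv_lt_0_compat; lra).
  assert (R0 + x <= R0); [ | lra]; apply HR1; split; [ lra | apply Hi].
  replace (w + RtoC (R0 + x) * (v - w) - (w + RtoC R0 * (v - w)))%C with (RtoC x * (v - w))%C by (rewrite RtoC_plus; ring).
  rewrite Cmod_mult, Cmod_R, Rabs_pos_eq by lra.
  assert (x * (Cmod (v - w) + 1) = e / 2) by (unfold x; field; lra); nra. }
assert (HR : 1 < R0) by (destruct HR0 as [HR0 | HR0]; auto; elim NR; now rewrite <- HR0).
set (F := disk_inverse f).
set (z t := F (w + RtoC t * (v - w))%C).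
assert (Hz : forall t, 1 <= t < R0 -> disk (z t) /\ f (z t) = (w + RtoC t * (v - w))%C).
{ intros t Ht; apply disk_inverse_spec, HI, Ht. }
set (Nz t := Re (z t) * Re (z t) + Im (z t) * Im (z t)).
assert (Nz_alt : forall t, Nz t = Cmod (z t) * Cmod (z t)) by (intros t; unfold Nz; apply (Cmod_sq_alt (z t))).
set (Q t := (w - k * z t - Cconj w * (z t * z t))%C).
assert (HN : forall t, 1 <= t < R0 ->
  is_derive Nz t (- (2 / t) * ((1 - Nz t) * Re (Cconj (z t) * w)%C))).
{ intros t Ht; destruct (Hz t Ht) as [Dz Ez].
  assert (N := injective_cder_ne_0 f f1 (z t) Hf Hf1 Hinj Dz).
  assert (Nt : RtoC t <> 0) by (intros E; apply RtoC_inj in E; lra).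
  assert (El : (/ f1 (z t) * (v - w))%C = (- (Q t * RtoC (/ t)))%C).
  { assert (HGz := HG (z t) Dz); fold (Q t) in HGz; rewrite Ez in HGz.
    assert (Ev : (v - w)%C = (- (f1 (z t) * Q t) / RtoC t)%C) by (rewrite <- HGz; field; auto).
    rewrite Ev, RtoC_inv by lra; field; auto. }
  assert (HF : cder F (w + RtoC t * (v - w))%C (/ f1 (z t))).
  { apply disk_inverse_cder; auto; now apply HI. }
  assert (Dx : is_derive (fun t => Re (z t)) t (Re (/ f1 (z t) * (v - w))%C)) by (now apply cder_line).
  assert (Dy : is_derive (fun t => Im (z t)) t (Im (/ f1 (z t) * (v - w))%C)).
  { rewrite Im_Re; apply (is_derive_ext (fun t => Re (- Ci * F (w + RtoC t * (v - w)))%C)).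
    - intros s; symmetry; apply Im_Re.
    - replace (- Ci * (/ f1 (z t) * (v - w)))%C with ((- Ci * / f1 (z t)) * (v - w))%C by ring.
      apply (cder_line (fun u => - Ci * F u)%C).
      apply cder_value with (0 * F (w + RtoC t * (v - w)) + - Ci * / f1 (z t))%C; [ ring | ].
      apply (cder_mult (fun _ => - Ci)%C F); [ apply cder_const | exact HF]. }
  rewrite El in Dx, Dy.
  assert (HD := is_derive_plus (V := R_NormedModule) _ _ t _ _
    (is_derive_mult (K := R_AbsRing) _ _ t _ _ Dx Dx Rmult_comm)
    (is_derive_mult (K := R_AbsRing) _ _ t _ _ Dy Dy Rmult_comm)).
  change plus with Rplus in HD; change mult with Rmult in HD.
  replace (- (2 / t) * ((1 - Nz t) * Re (Cconj (z t) * w)%C))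
    with (Re (- (Q t * RtoC (/ t))) * Re (z t) + Re (z t) * Re (- (Q t * RtoC (/ t))) +
          (Im (- (Q t * RtoC (/ t))) * Im (z t) + Im (z t) * Im (- (Q t * RtoC (/ t))))).
  - exact HD.
  (* [Re k = 0] kills the term in [k], and the other two terms of [Q] combine into the factor
     [1 - Nz t]. *)
  - unfold Nz, Q; destruct (z t) as [x y], w as [p q], k as [k1 k2]; unfold Re in Hk; simpl in Hk; subst k1.
    simpl; field; lra. }
(* Gronwall: for [t >= 1] the derivative of [1 - Nz] is at least [- 2 |w| (1 - Nz)], so
   [(1 - Nz t) * exp (2 |w| t)] increases and [1 - Nz] stays above [c] until [R0]. *)
set (c := (1 - Nz 1) * exp (2 * Cmod w * (1 - R0))).
assert (Hlt : forall t, 1 <= t < R0 -> Nz t < 1).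
{ intros t Ht; destruct (Hz t Ht) as [Dz _]; unfold disk in Dz; rewrite Nz_alt.
  generalize (Cmod_ge_0 (z t)); nra. }
assert (Hc : 0 < c).
{ apply Rmult_lt_0_compat; [ generalize (Hlt 1 ltac:(lra)); lra | apply exp_pos]. }
assert (Pw := Cmod_ge_0 w).
assert (Hbound : forall t, 1 <= t < R0 -> c <= 1 - Nz t).
{ intros t Ht.
  assert (Hmono : (1 - Nz 1) * exp (2 * Cmod w * 1) <= (1 - Nz t) * exp (2 * Cmod w * t)).
  { destruct (proj1 Ht) as [Ht' | <-]; [ | lra].
    destruct (MVT_cor2 (fun s => (1 - Nz s) * exp (2 * Cmod w * s))
      (fun s => (2 / s * ((1 - Nz s) * Re (Cconj (z s) * w)%C) + 2 * Cmod w * (1 - Nz s)) * exp (2 * Cmod w * s)) 1 t Ht') as [s [Es Hs]].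
    - intros s Hs; apply is_derive_Reals.
      assert (D := HN s ltac:(lra)).
      auto_derive.
      + eexists; exact D.
      + assert (ED := is_derive_unique _ _ _ D); change (Derive (fun x : R => Nz x) s = - (2 / s) * ((1 - Nz s) * Re (Cconj (z s) * w)%C)) in ED.
        rewrite ED; ring.
    - assert (H0 : 0 <= (2 / s * ((1 - Nz s) * Re (Cconj (z s) * w)%C) + 2 * Cmod w * (1 - Nz s)) * exp (2 * Cmod w * s)); [ | nra].
      apply Rmult_le_pos; [ | left; apply exp_pos].
      destruct (Hz s ltac:(lra)) as [Dz _]; unfold disk in Dz.
      specialize (Hlt s ltac:(lra)).
      assert (A1 : - Cmod w <= Re (Cconj (z s) * w)).
      { assert (A := re_le_Cmod (Cconj (z s) * w)); rewrite Cmod_mult, Cmod_conj in A.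
        apply Rabs_le_between in A; generalize (Cmod_ge_0 (z s)); nra. }
      assert (S1 : 0 < / s <= 1).
      { split; [ apply Rinv_0_lt_compat; lra | rewrite <- Rinv_1; apply Rinv_le_contravar; lra]. }
      replace (2 / s * ((1 - Nz s) * Re (Cconj (z s) * w)%C) + 2 * Cmod w * (1 - Nz s))
        with (2 * (1 - Nz s) * (/ s * Re (Cconj (z s) * w) + Cmod w)) by (field; lra).
      apply Rmult_le_pos; [ lra | ].
      assert (/ s * - Cmod w <= / s * Re (Cconj (z s) * w)) by (apply Rmult_le_compat_l; lra).
      nra. }
  unfold c; apply Rmult_le_reg_r with (exp (2 * Cmod w * t)); [ apply exp_pos | ].
  eapply Rle_trans; [ | exact Hmono].
  rewrite Rmult_assoc, <- exp_plus; apply Rmult_le_compat_l; [ generalize (Hlt 1 ltac:(lra)); lra | ].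
  assert (E : 2 * Cmod w * (1 - R0) + 2 * Cmod w * t <= 2 * Cmod w * 1) by nra.
  destruct E as [E | E]; [ left; now apply exp_increasing | right; now rewrite E]. }
(* [1 - c <= rho^2], so all preimages lie in the closed disk of radius [rho]. There [f] keeps a
   distance [d] from the endpoint at [R0], although the ray approaches it. *)
set (rho := 1 - c / 2).
destruct (compact_avoids (fun u => Cmod u <= rho) rho f (w + RtoC R0 * (v - w))%C) as [d [D Hd]].
{ auto. }
{ intros u Hu; apply Rnot_le_lt in Hu; exists (Cmod u - rho); split; [ lra | ]; intros u' Hu' K.
  generalize (Cmod_triangle_rev u u'); rewrite (Cmod_sub_sym u u'); lra. }
{ intros u Hu; apply chol2_ccont, Hf; unfold disk, rho in *; lra. }
{ intros u Hu E; apply NR; exists u; split; auto; unfold disk, rho in *; lra. }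
assert (P := Cmod_ge_0 (v - w)).
set (x := Rmin ((R0 - 1) / 2) (d / (2 * (Cmod (v - w) + 1)))).
assert (X0 : 0 < x) by (apply Rmin_glb_lt; [ lra | apply Rdiv_lt_0_compat; lra]).
assert (X1 : x <= (R0 - 1) / 2) by apply Rmin_l.
assert (X2 : x * (Cmod (v - w) + 1) <= d / 2).
{ apply Rle_trans with (d / (2 * (Cmod (v - w) + 1)) * (Cmod (v - w) + 1)).
  - apply Rmult_le_compat_r; [ lra | apply Rmin_r].
  - right; field; lra. }
assert (Ht : 1 <= R0 - x < R0) by lra.
destruct (Hz _ Ht) as [Dz Ez].
specialize (Hd (z (R0 - x))); specialize (Hbound _ Ht); rewrite Nz_alt in Hbound.
assert (Hle : Cmod (z (R0 - x)) <= rho).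
{ unfold rho; apply Rnot_lt_le; intros L.
  assert (c <= 1) by (generalize (Cmod_ge_0 (z (R0 - x))); nra). nra. }
specialize (Hd Hle); rewrite Ez in Hd.
replace (w + RtoC (R0 - x) * (v - w) - (w + RtoC R0 * (v - w)))%C with (- (RtoC x * (v - w)))%C in Hd by (rewrite RtoC_minus; ring).
rewrite Cmod_opp, Cmod_mult, Cmod_R, Rabs_pos_eq in Hd by lra; nra.
Qed.

(** * Plane cones *)

Definition cis (t : R) : C := (cos t, sin t).

Lemma Cmod_cis (t : R) : Cmod (cis t) = 1.
Proof.
unfold Cmod, cis; simpl fst; simpl snd.
replace (cos t ^ 2 + sin t ^ 2) with 1; [ apply sqrt_1 | ].
generalize (sin2_cos2 t); unfold Rsqr; lra.
Qed.

Lemma cis_plus (s t : R) : cis (s + t) = (cis s * cis t)%C.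
Proof. unfold cis; rewrite cos_plus, sin_plus; apply injective_projections; simpl; ring. Qed.

Lemma cis_0 : cis 0 = 1.
Proof. unfold cis; rewrite cos_0, sin_0; reflexivity. Qed.

Lemma cis_PI : cis PI = (- (1))%C.
Proof. unfold cis; rewrite cos_PI, sin_PI; apply injective_projections; simpl; ring. Qed.

Lemma cis_opp (t : R) : cis (- t) = Cconj (cis t).
Proof. unfold cis; rewrite cos_neg, sin_neg; reflexivity. Qed.

Lemma is_arg_exists (w : C) : w <> 0 -> exists t, is_arg w t.
Proof.
intros Hw; assert (P := proj1 (Cmod_gt_0 w) Hw).
assert (E := Cmod2_alt w); set (m := Cmod w) in *.
set (x := Re w / m); set (y := Im w / m).
assert (Exy : x * x + y * y = 1) by (unfold x, y; field_simplify; [ rewrite <- E; field; lra | lra]).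
assert (Hx : -1 <= x <= 1) by nra.
assert (Hs : sin (acos x) = Rabs y).
{ rewrite sin_acos by auto; rewrite <- sqrt_Rsqr_abs; f_equal; unfold Rsqr; lra. }
assert (Hb := acos_bound x).
assert (Hw' : w = (RtoC m * (x, y))%C).
{ unfold x, y; apply injective_projections; simpl; unfold Re, Im; field; lra. }
destruct (Rle_lt_dec 0 y) as [Hy | Hy].
- exists (acos x); split; [ generalize PI_RGT_0; lra | ].
  rewrite Hs, cos_acos, Rabs_pos_eq by auto; exact Hw'.
- exists (- acos x); split.
  + assert (acos x <> PI); [ | lra].
    intros Ep; rewrite Ep, sin_PI, Rabs_left in Hs by auto; lra.
  + rewrite cos_neg, sin_neg, Hs, cos_acos, Rabs_left by auto.
    replace (- - y) with y by ring; exact Hw'.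
Qed.

Definition open_cone (S : C -> Prop) : Prop :=
  convex_set S /\ (forall u, S u -> exists e, 0 < e /\ forall v, Cmod (v - u) < e -> S v) /\
  (forall u t, S u -> 0 < t -> S (RtoC t * u)%C) /\ ~ S 0.

Lemma open_cone_add (S : C -> Prop) (u v : C) : open_cone S -> S u -> S v -> S (u + v)%C.
Proof.
intros [Hc [_ [Hh _]]] Hu Hv.
replace (u + v)%C with (RtoC 2 * (RtoC (1 - / 2) * u + RtoC (/ 2) * v))%C.
- apply Hh; [ apply Hc; auto; lra | lra].
- apply injective_projections; simpl; field.
Qed.

Lemma cis_continuous (t e : R) : 0 < e -> exists d, 0 < d /\ forall s, Rabs (s - t) < d -> Cmod (cis s - cis t) < e.
Proof.
intros He.
assert (H : forall g, continuity g -> exists d, 0 < d /\ forall s, Rabs (s - t) < d -> Rabs (g s - g t) < e / 2).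
{ intros g Hg; destruct (Hg t (e / 2)) as [d [D K]]; [ lra | ].
  exists d; split; auto; intros s Hs; destruct (Req_dec s t) as [-> | N].
  - rewrite Rminus_diag, Rabs_R0; lra.
  - apply K; split; [ split; [ exact I | auto] | exact Hs]. }
destruct (H cos continuity_cos) as [d1 [D1 K1]]; destruct (H sin continuity_sin) as [d2 [D2 K2]].
exists (Rmin d1 d2); split; [ now apply Rmin_glb_lt | ]; intros s Hs.
specialize (K1 s (Rlt_le_trans _ _ _ Hs (Rmin_l _ _))).
specialize (K2 s (Rlt_le_trans _ _ _ Hs (Rmin_r _ _))).
eapply Rle_lt_trans; [ apply Cmod_le_Re_Im | ].
replace (Re (cis s - cis t)) with (cos s - cos t) by (simpl; ring).
replace (Im (cis s - cis t)) with (sin s - sin t) by (simpl; ring); lra.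
Qed.

(** For [0 < t < t' < PI] the point [cis t] is a positive combination of 1 and [cis t'], with the
    coefficients of the law of sines, so the angles in [S] are closed downwards. Openness excludes
    their supremum, and [PI] is excluded because [1 + (-1)] would be in [S]. *)
Lemma open_cone_angle (S : C -> Prop) :
  open_cone S -> S 1 ->
  exists a, 0 < a <= PI /\ forall t, 0 <= t <= PI -> (S (cis t) <-> t < a).
Proof.
intros HS S1; assert (Hadd := fun u v => open_cone_add S u v HS); destruct HS as [_ [Ho [Hh H0]]].
assert (NPI : ~ S (cis PI)).
{ intros H; apply H0; rewrite cis_PI in H; replace (RtoC 0) with (1 + - (1))%C by ring; auto. }
assert (PP := PI_RGT_0).
assert (Hdown : forall t t', 0 <= t < t' -> t' <= PI -> S (cis t') -> S (cis t)).
{ intros t t' Ht Ht' H.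
  destruct (Req_dec t' PI) as [-> | Np]; [ now elim NPI | ].
  destruct (Req_dec t 0) as [-> | N0]; [ now rewrite cis_0 | ].
  assert (s1 : 0 < sin t') by (apply sin_gt_0; lra).
  assert (s2 : 0 < sin t) by (apply sin_gt_0; lra).
  assert (s3 : 0 < sin (t' - t)) by (apply sin_gt_0; lra).
  replace (cis t) with (RtoC (sin (t' - t) / sin t') * 1 + RtoC (sin t / sin t') * cis t')%C.
  - apply Hadd; auto; apply Hh; auto; now apply Rdiv_lt_0_compat.
  - rewrite sin_minus; unfold cis; apply injective_projections; simpl; field; lra. }
assert (Hopen : forall t, S (cis t) -> exists d, 0 < d /\ forall s, Rabs (s - t) < d -> S (cis s)).
{ intros t H; destruct (Ho _ H) as [e [He K]]; destruct (cis_continuous t e He) as [d [D L]].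
  exists d; split; auto. }
destruct (completeness (fun t => 0 <= t <= PI /\ S (cis t))) as [a [Ha1 Ha2]].
{ exists PI; intros t [Ht _]; lra. }
{ exists 0; split; [ lra | now rewrite cis_0]. }
assert (HaPI : a <= PI) by (apply Ha2; intros t [Ht _]; lra).
assert (Hext : forall t, 0 <= t <= PI -> S (cis t) -> t < a).
{ intros t Ht H; destruct (Req_dec t PI) as [-> | Np]; [ now elim NPI | ].
  destruct (Hopen t H) as [d [D K]].
  set (x := Rmin (d / 2) (PI - t)).
  assert (X0 : 0 < x) by (apply Rmin_glb_lt; lra).
  assert (X1 : x <= d / 2) by apply Rmin_l; assert (X2 : x <= PI - t) by apply Rmin_r.
  assert (t + x <= a); [ | lra]; apply Ha1; split; [ lra | apply K].
  replace (t + x - t) with x by ring; rewrite Rabs_pos_eq; lra. }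
exists a; split; [ split; auto; apply Hext; [ lra | now rewrite cis_0] | ].
intros t Ht; split; [ now apply Hext | ]; intros L; apply NNPP; intros N.
assert (a <= t); [ | lra]; apply Ha2; intros t' [Ht' H'].
apply Rnot_lt_le; intros L'; apply N, (Hdown t t'); auto; lra.
Qed.

Lemma open_cone_conj (S : C -> Prop) : open_cone S -> open_cone (fun u => S (Cconj u)).
Proof.
intros [Hc [Ho [Hh H0]]]; repeat split.
- intros u v t Hu Hv Ht; rewrite Cplus_conj, !Cmult_conj.
  replace (Cconj (RtoC (1 - t))) with (RtoC (1 - t)) by (apply injective_projections; simpl; ring).
  replace (Cconj (RtoC t)) with (RtoC t) by (apply injective_projections; simpl; ring).
  now apply Hc.
- intros u Hu; destruct (Ho _ Hu) as [e [He K]]; exists e; split; auto; intros v Hv; apply K.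
  rewrite <- Cminus_conj, Cmod_conj; auto.
- intros u t Hu Ht; rewrite Cmult_conj.
  replace (Cconj (RtoC t)) with (RtoC t) by (apply injective_projections; simpl; ring); auto.
- replace (Cconj 0) with (RtoC 0) by (apply injective_projections; simpl; ring); auto.
Qed.

(** The upper and lower half-planes give the angles [- b < t < a], the lower one by conjugation;
    [m = (a - b) / 2] is the bisector and [a + b = PI * beta] the opening. *)
Lemma open_cone_sector (S : C -> Prop) :
  open_cone S -> S 1 ->
  exists beta m, 0 < beta <= 1 /\ forall u, S u <-> standard_sector beta (cis (- m) * u)%C.
Proof.
intros HS S1.
destruct (open_cone_angle S HS S1) as [a [Ha Hup]].
destruct (open_cone_angle _ (open_cone_conj S HS)) as [b [Hb Hlow]].
{ replace (Cconj 1) with (RtoC 1) by (apply injective_projections; simpl; ring); auto. }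
assert (PP := PI_RGT_0).
assert (Hadd := fun u v => open_cone_add S u v HS).
assert (Hab : a + b <= PI).
(* The midpoint of [PI - b] and [a]: both [cis t] and its opposite would lie in [S], and so would
   their sum 0. *)
{ apply Rnot_lt_le; intros L; set (t := (PI - b + a) / 2).
  assert (H1 : S (cis t)) by (apply Hup; unfold t; lra).
  assert (H2 : S (Cconj (cis (PI - t)))) by (apply Hlow; unfold t; lra).
  rewrite <- cis_opp in H2; replace (- (PI - t)) with (t + - PI) in H2 by ring.
  rewrite cis_plus, cis_opp, cis_PI in H2.
  apply (proj2 (proj2 (proj2 HS))).
  replace (RtoC 0) with (cis t + cis t * Cconj (- (1)))%C; auto.
  rewrite Copp_conj; replace (Cconj 1) with (RtoC 1) by (apply injective_projections; simpl; ring); ring. }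
assert (Hcis : forall t, - b < t < a -> S (cis t)).
{ intros t Ht; destruct (Rle_lt_dec 0 t); [ apply Hup; lra | ].
  replace t with (- (- t)) by ring; rewrite cis_opp; apply Hlow; lra. }
destruct HS as [Hc [Ho [Hh H0]]].
exists ((a + b) / PI), ((a - b) / 2); split.
{ split; [ apply Rdiv_lt_0_compat; lra | ].
  apply Rmult_le_reg_r with PI; auto; unfold Rdiv; rewrite Rmult_assoc, Rinv_l; lra. }
intros u; set (m := (a - b) / 2); unfold standard_sector.
replace (PI * ((a + b) / PI) / 2) with ((a + b) / 2) by (field; lra).
assert (Hcm : Cmod (cis (- m) * u) = Cmod u) by (rewrite Cmod_mult, Cmod_cis; ring).
assert (Hmm : (cis m * cis (- m))%C = 1) by (rewrite <- cis_plus, Rplus_opp_r; apply cis_0).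
split.
- intros Hu.
  assert (Nu : u <> 0) by (intros ->; auto).
  assert (Pu := proj1 (Cmod_gt_0 u) Nu).
  destruct (is_arg_exists u Nu) as [t [Ht Et]]; change (cos t, sin t) with (cis t) in Et.
  assert (Hcu : S (cis t)).
  { replace (cis t) with (RtoC (/ Cmod u) * u)%C; [ apply Hh; auto; now apply Rinv_0_lt_compat | ].
    rewrite Et at 2; rewrite RtoC_inv by lra; field; intros E; apply RtoC_inj in E; lra. }
  assert (Htab : - b < t < a).
  { destruct (Rle_lt_dec 0 t).
    - split; [ lra | apply Hup; auto; lra].
    - split; [ | lra].
      assert (- t < b); [ | lra]; apply Hlow; [ lra | rewrite <- cis_opp, Ropp_involutive; auto]. }
  split.
  + apply Cmod_gt_0; rewrite Hcm; auto.
  + exists (- m + t); split; [ | apply Rabs_def1; unfold m; lra].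
    split; [ unfold m; lra | rewrite Hcm; change (cos (- m + t), sin (- m + t)) with (cis (- m + t))].
    rewrite cis_plus, Et at 1; ring.
- intros [N [t [[Ht Et] Hlt]]]; apply Rabs_def2 in Hlt.
  rewrite Hcm in Et; change (cos t, sin t) with (cis t) in Et.
  replace u with (RtoC (Cmod u) * cis (m + t))%C.
  + apply Hh; [ apply Hcis; unfold m; lra | rewrite <- Hcm; now apply Cmod_gt_0].
  + rewrite cis_plus; replace (RtoC (Cmod u) * (cis m * cis t))%C with (cis m * (RtoC (Cmod u) * cis t))%C by ring.
    rewrite <- Et, Cmult_assoc, Hmm; ring.
Qed.

(** The borderline opening [beta = 1], which [is_infinite_sector] excludes and which gives the
    halfplane. *)
Lemma standard_sector_1 (u : C) : standard_sector 1 u <-> 0 < Re u.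
Proof.
assert (PP := PI_RGT_0); unfold standard_sector; rewrite Rmult_1_r; split.
- intros [N [t [[_ E] Ht]]]; apply Rabs_def2 in Ht.
  rewrite E, re_scal_l; apply Rmult_lt_0_compat; [ now apply Cmod_gt_0 | apply cos_gt_0; lra].
- intros H; assert (N : u <> 0) by (intros ->; simpl in H; lra).
  split; auto; destruct (is_arg_exists u N) as [t [Ht E]]; exists t; split; [ now split | ].
  assert (P := proj1 (Cmod_gt_0 u) N).
  rewrite E, re_scal_l in H; change (Re (cos t, sin t)) with (cos t) in H.
  assert (Hc : 0 < cos t) by (apply Rmult_lt_reg_l with (Cmod u); lra).
  apply Rabs_def1; apply Rnot_le_lt; intros L.
  + assert (cos t <= 0) by (apply cos_le_0; lra); lra.
  + rewrite <- cos_neg in Hc; assert (cos (- t) <= 0) by (apply cos_le_0; lra); lra.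
Qed.

Theorem theorem2p1 :
  forall f : C -> C,
    convex_mapping f ->
    (exists zeta w : C,
       Cmod zeta = 1 /\
       boundary_value f zeta (Fin w) /\
       Re (second_coeff f * w) = - (1 / 2)) ->
    is_halfplane (image f disk) \/ is_infinite_sector (image f disk).
Proof.
intros f [Hf [Hinj [f00 [f10 Hconv]]]] [zeta [w [Hz [Hb Ha]]]].
set (f1 := C_derive f) in *.
destruct (analytic_on_C_derive disk f disk_open Hf) as [Hf1 Af1]; fold f1 in Hf1, Af1.
destruct (analytic_on_C_derive disk f1 disk_open Af1) as [Hf2 _].
assert (Cf := analytic_chol2 f Hf); assert (Cf1 := analytic_chol2 f1 Af1).
assert (Hstar := image_star f zeta w Cf Hinj Hconv Hz Hb).
assert (Nw := boundary_value_not_image f zeta w Cf Hinj Hz Hb).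
(* Since [f'' 0 = 2 a_2], this is the hypothesis on [a_2 * w]. *)
assert (Hk : Re (1 + w * C_derive f1 0)%C = 0).
{ replace (1 + w * C_derive f1 0)%C with (1 + RtoC 2 * (second_coeff f * w))%C.
  - rewrite re_plus, re_scal_l, Ha, re_RtoC; lra.
  - unfold second_coeff; fold f1; field; intros E; apply RtoC_inj in E; lra. }
assert (HG := generator_quadratic f f1 (C_derive f1) w Cf Hf1 Cf1 Hf2 Hinj f00 f10 Hstar Hk).
assert (Hray := image_ray f f1 w _ Cf Hf1 Hinj Hstar HG Hk).
assert (D0 : disk 0) by (unfold disk; rewrite Cmod_0; lra).
assert (I0 : image f disk 0) by (exists (RtoC 0); auto).
assert (w0 : w <> 0) by (intros ->; auto).
(* The coordinate [u] puts the vertex [w] at 0 and the point [f 0 = 0] at 1; it needs [w <> 0], true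
   because 0 is in the image and [w] is not. *)
set (S u := image f disk (w - w * u)%C).
assert (HS : open_cone S).
{ repeat split; unfold S.
  - intros u v t Hu Hv Ht.
    replace (w - w * (RtoC (1 - t) * u + RtoC t * v))%C
      with (RtoC (1 - t) * (w - w * u) + RtoC t * (w - w * v))%C by (rewrite RtoC_minus; ring).
    now apply Hconv.
  - intros u Hu; destruct (image_open f _ Cf Hinj Hu) as [e [He K]].
    assert (P := proj1 (Cmod_gt_0 w) w0).
    exists (e / Cmod w); split; [ now apply Rdiv_lt_0_compat | ]; intros v Hv; apply K.
    replace (w - w * v - (w - w * u))%C with (- (w * (v - u)))%C by ring.
    rewrite Cmod_opp, Cmod_mult.
    replace e with (Cmod w * (e / Cmod w)) by (field; lra); now apply Rmult_lt_compat_l.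
  (* Expansions come from the reversed flow, contractions from convexity. *)
  - intros u t Hu Ht; destruct (Rle_lt_dec 1 t) as [L | L].
    + replace (w - w * (RtoC t * u))%C with (w + RtoC t * ((w - w * u) - w))%C by ring; auto.
    + replace (w - w * (RtoC t * u))%C with ((w - w * u) + RtoC (1 - t) * (w - (w - w * u)))%C by (rewrite RtoC_minus; ring).
      apply Hstar; auto; lra.
  - replace (w - w * 0)%C with w by ring; auto. }
destruct (open_cone_sector S HS) as [beta [m [Hbeta Hsec]]].
{ unfold S; replace (w - w * 1)%C with (RtoC 0) by ring; auto. }
assert (Hmm : (cis m * cis (- m))%C = 1) by (rewrite <- cis_plus, Rplus_opp_r; apply cis_0).
assert (NA : (- (w * cis m))%C <> 0).
{ apply Cmod_gt_0; rewrite Cmod_opp, Cmod_mult, Cmod_cis, Rmult_1_r; now apply Cmod_gt_0. }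
assert (Haff : forall v, image f disk v <-> affine_image (- (w * cis m)) w (standard_sector beta) v).
{ intros v; split.
  - intros Hv; exists (cis (- m) * ((w - v) / w))%C; split.
    + apply Hsec; unfold S; replace (w - w * ((w - v) / w))%C with v by (field; auto); auto.
    + replace (- (w * cis m) * (cis (- m) * ((w - v) / w)) + w)%C
        with (w - (cis m * cis (- m)) * (w * ((w - v) / w)))%C by ring.
      rewrite Hmm; field; auto.
  - intros [p [Hp <-]].
    replace (- (w * cis m) * p + w)%C with (w - w * (cis m * p))%C by ring; apply Hsec.
    rewrite Cmult_assoc, (Cmult_comm (cis (- m))), Hmm, Cmult_1_l; auto. }
destruct Hbeta as [B0 [B1 | ->]].
- right; exists beta, (- (w * cis m))%C, w; repeat split; auto; apply Haff.
- left; exists (- (w * cis m))%C, w; split; auto; intros v; rewrite Haff.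
  split; intros [p [Hp Ep]]; exists p; split; auto; now apply standard_sector_1.
Qed.
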